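(* Let $G$ be the free semigroup generated by continuous maps $f_1,\dots,f_m$ acting on a compact metric space $(X,d)$, and let $\mu$ be a $G$-invariant Borel probability measure on $X$ with full support satisfying the weak entropy-doubling condition of free semigroup actions. If the limit process of $H(\omega,x)$ is uniform with respect to $(\omega,x)$ and $H(\omega,x)\le h_\mu(G)$ for $\mathbb{P}\times\mu$-almost every $(\omega,x)\in\Sigma_m^+\times X$, then for every real $q\le0$ the entropy $h_{cor}(G,\mu,q)$ exists (i.e. $\overline{h}_{cor}(G,\mu,q)=\underline{h}_{cor}(G,\mu,q)$) and $$h_{cor}(G,\mu,q)=h_\mu(G).$$ In particular, $$h_{top}(G)=h_{cor}(G,\mu,0)=h_\mu(G).$$
   Context: Setting. $(X,d)$ is a compact metric space, $f_1,\dots,f_m:X\to X$ are continuous, $G$ is the free semigroup generated by $\{f_1,\dots,f_m\}$ acting on $X$. Fix a probability vector $p=(p_1,\dots,p_m)$ with all $p_i>0$ and $\sum_i p_i=1$; let $\Sigma_m^+=\{1,\dots,m\}^{\mathbb{N}}$, let $\mathbb{P}$ be the Bernoulli (product) measure on $\Sigma_m^+$ generated by $p$, and let $\sigma$ be the left shift on $\Sigma_m^+$. For $\omega=(i_1,i_2,\dots)\in\Sigma_m^+$ put $f_{\omega,0}=\mathrm{id}$ and $f_{\omega,n}=f_{i_n}\circ\cdots\circ f_{i_1}$ for $n\ge1$. For $k\ge 1$ put $$d^G_{\omega,k}(x,y)=\max_{0\le i\le k-1} d(f_{\omega,i}(x),f_{\omega,i}(y)),\qquad B^G_{\omega,k}(x,\varepsilon)=\{y\in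 X: d^G_{\omega,k}(x,y)\le\varepsilon\}.$$ The skew product is $F(\omega,x)=(\sigma(\omega),f_{\omega,1}(x))$ on $\Sigma_m^+\times X$. A Borel probability measure $\mu$ on $X$ is $G$-invariant if $\mathbb{P}\times\mu$ is $F$-invariant. Weak entropy-doubling condition of free semigroup actions: for all sufficiently small $\varepsilon>0$, $$\limsup_{k\to+\infty}\frac1k\log\sup_{x\in X}\frac{\mu(B^G_{\omega,k}(x,2\varepsilon))}{\mu(B^G_{\omega,k}(x,\varepsilon))}=0\quad\text{for }\mathbb{P}\text{-a.e. }\omega\in\Sigma_m^+.$$ Upper local entropy. $H(\omega,x)=\lim_{\varepsilon\to0}\limsup_{k\to+\infty}-\frac1k\log\mu(B^G_{\omega,k}(x,\varepsilon))$. The limit process of $H(\omega,x)$ is uniform with respect to $(\omega,x)$ if there is a set $A\subseteq\Sigma_m^+\times X$ with $(\mathbb{P}\times\mu)(A)=1$ such that for every $\delta>0$ there is $\varepsilon_0=\varepsilon_0(\delta)>0$ such that for every $0<\varepsilon\le\varepsilon_0$ there is $K=K(\delta,\varepsilon)$ such that for all $k>K$, $$-\frac1k\log\mu(B^G_{\omega,k}(x,\varepsilon))\le H(\omega,x)+\delta\quad\text{for all }(\omega,x)\in A.$$ Topological entropy. A set $E\subseteq X$ is $(\omega,k,\varepsilon)$-separated if $d^G_{\omega,k}(x,y)>\varepsilon$ for all distinct $x,y\in E$; $E(\omega,k,\varepsilon)$ denotes such a set of largest cardinality. Then $h_{top}(G)=\lim_{\varepsilon\to0}\liminf_{k\to+\infty}\frac1k\int_{\Sigma_m^+}\log\sharp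 E(\omega,k,\varepsilon)\,d\mathbb{P}(\omega)$. Measure-theoretic entropy. For a finite Borel measurable partition $\xi$ of $X$, $h_\mu(G,\xi)=\lim_{k\to+\infty}\frac1k\int_{\Sigma_m^+}H_\mu\big(\bigvee_{i=0}^{k-1}f_{\omega,i}^{-1}\xi\big)d\mathbb{P}(\omega)$, where $H_\mu(\eta)=-\sum_{A\in\eta}\mu(A)\log\mu(A)$; $h_\mu(G)=\sup_\xi h_\mu(G,\xi)$. Correlation entropy. For $q\neq1$, $c(G,\mu,\varepsilon,k,q)=\frac1{q-1}\int_{\Sigma_m^+}\log\big(\int_X\mu(B^G_{\omega,k}(x,\varepsilon))^{q-1}d\mu(x)\big)d\mathbb{P}(\omega)$. Then $\overline{h}_{cor}(G,\mu,q)=\lim_{\varepsilon\to0}\limsup_{k\to+\infty}-\frac1kc(G,\mu,\varepsilon,k,q)$ and $\underline{h}_{cor}(G,\mu,q)=\lim_{\varepsilon\to0}\liminf_{k\to+\infty}-\frac1kc(G,\mu,\varepsilon,k,q)$; if they coincide the common value is $h_{cor}(G,\mu,q)$. *)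

(* Defs.v *)
From HB Require Import structures.
From mathcomp Require Import all_boot all_order all_algebra finmap.
From mathcomp Require Import all_classical all_reals all_analysis.

Set Implicit Arguments.
Unset Strict Implicit.
Unset Printing Implicit Defensive.

Import Order.TTheory GRing.Theory Num.Theory.
Import numFieldNormedType.Exports.

Local Open Scope classical_set_scope.
Local Open Scope ring_scope.

(* A measurableType has a distinguished point, hence so does the space X, which
   is nonempty as it carries a probability; and, for the same reason, the number
   of generators, which is at least 1, is written m.+1. *)
#[short(type="pointedMetricType")]
HB.structure Definition PointedMetric (K : numDomainType) :=
  {M of Metric K M & isPointed M}.

HB.instance Definition _ (m : nat) := isPointed.Build 'I_m.+1 ord0.

(* The symbols are encoded by 'I_m.+1, i.e. counted from 0, and
   omega = (i_1, i_2, ...) by the function n |-> i_{n+1}. *)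
Definition cylinder (m n : nat) (w : n.-tuple 'I_m.+1) : set (nat -> 'I_m.+1) :=
  [set omega | forall i : 'I_n, omega i = tnth w i].

Definition cylinders (m : nat) : set (set (nat -> 'I_m.+1)) :=
  [set C | exists n (w : n.-tuple 'I_m.+1), C = cylinder w].

(* One-sided sequences, with the product sigma-algebra. *)
Notation Sigma m := (g_sigma_algebraType (@cylinders m)).

Notation borel X := (g_sigma_algebraType (@open X)).

Definition probability_vector (R : realType) (m : nat) (p : 'I_m.+1 -> R) : Prop :=
  (forall i, 0 < p i) /\ \sum_(i < m.+1) p i = 1.

(* Cylinders form a pi-system generating the sigma-algebra of Sigma m, so these
   values determine P. *)
Definition is_bernoulli (R : realType) (m : nat) (p : 'I_m.+1 -> R)
    (P : probability (Sigma m) R) : Prop :=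
  forall n (w : n.-tuple 'I_m.+1),
    P (cylinder w) = (\prod_(i < n) p (tnth w i))%:E.

Definition shift (m : nat) (omega : Sigma m) : Sigma m := fun n => omega n.+1.

Section Action.
Context (R : realType) (X : pointedMetricType R) (m : nat) (f : 'I_m.+1 -> X -> X).

Fixpoint fiter (omega : Sigma m) (n : nat) : X -> X :=
  if n is n'.+1 then f (omega n') \o fiter omega n' else id.

(* The index value 0 is neutral, distances being nonnegative. *)
Definition bowen_dist (omega : Sigma m) (k : nat) (x y : X) : R :=
  \big[Num.max/0]_(i < k) mdist (fiter omega i x) (fiter omega i y).

Definition bowen_ball (omega : Sigma m) (k : nat) (x : X) (e : R) : set X :=
  [set y | bowen_dist omega k x y <= e].

Definition skew_product (z : Sigma m * borel X) : Sigma m * borel X :=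
  (shift z.1, fiter z.1 1 z.2).

Definition separated_set (omega : Sigma m) (k : nat) (e : R) (E : {fset X}) : Prop :=
  forall x y, x \in E -> y \in E -> x != y -> e < bowen_dist omega k x y.

Local Open Scope ereal_scope.

(* Largest cardinality of an (omega, k, e)-separated set. *)
Definition sep_card (omega : Sigma m) (k : nat) (e : R) : \bar R :=
  ereal_sup [set (#|` E|%:R)%:E | E in [set E | separated_set omega k e E]].

(* Here and below, the expression is monotone in e, so that the limit e -> 0+
   exists in \bar R. *)
Definition htop (P : probability (Sigma m) R) : \bar R :=
  lim (limn_einf (fun k : nat =>
    (k%:R^-1)%:E * \int[P]_omega lne (sep_card omega k e)) @[e --> (0 : R)%R^'+]).

Section InvariantMeasure.
Context (P : probability (Sigma m) R) (mu : probability (borel X) R).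

Definition G_invariant : Prop :=
  forall A : set (Sigma m * borel X), measurable A ->
    (P \x mu) (skew_product @^-1` A) = (P \x mu) A.

Definition full_support : Prop :=
  forall U : set X, open U -> U !=set0 -> 0 < mu U.

Definition weak_entropy_doubling : Prop :=
  \forall e \near (0 : R)%R^'+, {ae P, forall omega,
    limn_esup (fun k : nat => (k%:R^-1)%:E *
      lne (ereal_sup [set mu (bowen_ball omega k x (2 * e)%R) /
                          mu (bowen_ball omega k x e) | x in [set: X]])) = 0}.

Definition ball_rate (omega : Sigma m) (k : nat) (x : X) (e : R) : \bar R :=
  - ((k%:R^-1)%:E * lne (mu (bowen_ball omega k x e))).

Definition upper_local_entropy (omega : Sigma m) (x : X) : \bar R :=
  lim (limn_esup (fun k : nat => ball_rate omega k x e) @[e --> (0 : R)%R^'+]).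

Definition uniform_local_entropy : Prop :=
  exists A : set (Sigma m * borel X),
    [/\ measurable A, (P \x mu) A = 1 &
      forall delta : R, (0 < delta)%R ->
      exists2 e0 : R, (0 < e0)%R &
      forall e : R, (0 < e <= e0)%R ->
      exists K : nat, forall k : nat, (K < k)%N ->
      forall omega x, A (omega, x) ->
        ball_rate omega k x e <= upper_local_entropy omega x + delta%:E].

(* Finite partitions are indexed families; empty cells are allowed, and do not
   contribute to the entropy, since 0 * lne 0 = 0. *)
Definition measurable_partition (n : nat) (xi : 'I_n -> set (borel X)) : Prop :=
  [/\ forall i, measurable (xi i), trivIset [set: 'I_n] xi &
      \bigcup_(i in [set: 'I_n]) xi i = [set: borel X]].

Definition partition_entropy (I : finType) (eta : I -> set (borel X)) : \bar R :=
  - \sum_(i : I) mu (eta i) * lne (mu (eta i)).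

(* The cells of the join of the partitions f_{omega,i}^{-1} xi, i < k, are
   indexed by the choice of a cell of xi for each i. *)
Definition partition_join (n : nat) (xi : 'I_n -> set (borel X))
    (omega : Sigma m) (k : nat) (a : {ffun 'I_k -> 'I_n}) : set (borel X) :=
  \bigcap_(i in [set: 'I_k]) fiter omega i @^-1` xi (a i).

Definition hmu_part (n : nat) (xi : 'I_n -> set (borel X)) : \bar R :=
  limn (fun k : nat => (k%:R^-1)%:E *
    \int[P]_omega partition_entropy (@partition_join n xi omega k)).

Definition hmu : \bar R :=
  ereal_sup [set h | exists n (xi : 'I_n -> set (borel X)),
    measurable_partition xi /\ h = hmu_part xi].

(* Meaningful for q != 1. The library has 0 `^ r = 0 for r < 0; this case does
   not occur when mu has full support and the f i are continuous, all balls
   having then positive measure. *)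
Definition correlation (e : R) (k : nat) (q : R) : \bar R :=
  ((q - 1)^-1)%:E * \int[P]_omega
    lne (\int[mu]_x (mu (bowen_ball omega k x e) `^ (q - 1))).

Definition hcor_upper (q : R) : \bar R :=
  lim (limn_esup (fun k : nat =>
    - ((k%:R^-1)%:E * correlation e k q)) @[e --> (0 : R)%R^'+]).

Definition hcor_lower (q : R) : \bar R :=
  lim (limn_einf (fun k : nat =>
    - ((k%:R^-1)%:E * correlation e k q)) @[e --> (0 : R)%R^'+]).

Definition hcor_exists (q : R) : Prop := hcor_upper q = hcor_lower q.

(* The common value, meaningful when [hcor_exists q] holds. *)
Definition hcor (q : R) : \bar R := hcor_upper q.

End InvariantMeasure.
End Action.

(* Main.v *)
Require Import Defs.
From HB Require Import structures.
From mathcomp Require Import all_boot all_order all_algebra finmap.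
From mathcomp Require Import all_classical all_reals all_analysis.
From mathcomp Require Import lra measurable_realfun.

(** Write h for the entropy of mu and M(w, k, e, q) for the integral over x of
    mu(B_{w,k}(x, e)) to the power q - 1. For q <= 0 both sequences

      k^-1 \int log sep(w, k, e) dP   and
      (1 - q)^-1 k^-1 \int log M(w, k, e, q) dP

    are, for k large, between bounds that tend to h as e tends to 0; each of the
    limits in the statement is taken along one of them.

    From above ([rate_upper_bound]): uniformity of the local entropy and H <= h
    say that, for almost every w, almost every x has
    mu(B_{w,k}(x, e)) >= exp(-k (h + delta)). Raised to the power q - 1 and
    integrated, this bounds M. It also bounds the size of a 4e-separated set:
    each of its points is within e of a generic point, because balls have
    positive measure, and the e-balls around these generic points are disjoint
    and each of measure at least exp(-k (h + delta)).

    From below ([rate_lower_bound]): fix a finite partition xi with n cells.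
    Outside a set D of small measure, nearby points lie in the same cell
    ([partition_separable_off_small]). Describe the orbit segment of length k
    of a point by the word of pairs (cell of xi, membership in D), and give
    such a word the product of the weights of its letters, which is a / n for a
    letter in D and 1 - a for the others. A small Bowen ball meets words of
    total weight at most 1: at each time it sees at most one letter off D, and
    the n letters in D weigh a together ([sum_itinerary_weight_le1]). Comparing
    the joint distribution of the word and of a cell of a cover by Bowen balls
    with its competitors through ln t <= t - 1 ([entropy_le_cross_sum]) gives

      H_mu (join of xi along w) <= - sum_y mu(Q_y) ln mu(B(y, 2e)) + error,

    for measurable cells Q_y included in B(y, e). The error is the mean of minus
    the logarithm of the weight of a word; its part due to D is a multiple of
    the sum over i < k of mu(f_{w,i}^-1 D); by invariance the P-average of each
    summand is mu(D), so that the error per unit of time is as small as wanted.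
    Finally, Jensen's inequality bounds the sum over y by (1 - q)^-1 log M for
    any finite cover, and by log sep when the centers y form a maximal separated
    set. Hence liminf of either rate is at least h_mu(G, xi), up to the error. *)

Set Implicit Arguments.
Unset Strict Implicit.
Unset Printing Implicit Defensive.

Import Order.TTheory GRing.Theory Num.Theory.
Import numFieldNormedType.Exports.

Local Open Scope classical_set_scope.
Local Open Scope ring_scope.

(** * Inequalities for finite sums *)

Section FiniteSums.
Context {R : realType}.

Lemma powR_le0_antitone (r x y : R) : r <= 0 -> 0 < x -> x <= y ->
  y `^ r <= x `^ r.
Proof.
move=> r0 x0 xy; have y0 := lt_le_trans x0 xy.
by rewrite /powR !gt_eqF// ler_expR ler_wnM2l// ler_ln ?posrE.
Qed.

Lemma lne_expR (c : R) : lne (expR c)%:E = c%:E.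
Proof. by rewrite lne_EFin ?expR_gt0// expRK. Qed.

Lemma sum_pair_cond (I J : finType) (QI : pred I) (QJ : pred J)
    (G : I * J -> R) (Q : pred (I * J)) :
    (forall p, Q p = QI p.1 && QJ p.2) ->
  \sum_(p | Q p) G p = \sum_(i | QI i) \sum_(j | QJ j) G (i, j).
Proof.
move=> QE; rewrite (eq_bigl _ _ QE) pair_big /=.
by apply: eq_bigr => -[i j] _.
Qed.

Lemma ln_prod (I : finType) (g : I -> R) :
  (forall i, 0 < g i) -> ln (\prod_i g i) = \sum_i ln (g i).
Proof.
move=> g0; suff [] : 0 < \prod_i g i /\ ln (\prod_i g i) = \sum_i ln (g i) by [].
elim/big_rec2 : _ => [|i y1 y2 _ [y20 <-]]; first by rewrite ln1.
by rewrite mulr_gt0// lnM ?posrE.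
Qed.

Lemma ln_le_subr1 (t : R) : 0 < t -> ln t <= t - 1.
Proof.
move=> t0; have := @le_ln1Dx R (t - 1).
by rewrite [1 + _]addrC subrK; apply; rewrite ltrBrDr addNr.
Qed.

Lemma weighted_sum_gt0 (J : finType) (kappa t : J -> R) :
    (forall j, 0 <= kappa j) -> \sum_j kappa j = 1 -> (forall j, 0 < t j) ->
  0 < \sum_j kappa j * t j.
Proof.
move=> k0 k1 t0.
have [j kj] : exists j, 0 < kappa j.
  apply: contrapT => h; have : \sum_j kappa j <= 0.
    by apply: sumr_le0 => j _; rewrite leNgt; apply/negP => ?; apply: h; exists j.
  by rewrite k1 ler10.
rewrite (bigD1 j)//= ltr_pwDl ?mulr_gt0// sumr_ge0// => i _.
by rewrite mulr_ge0// ltW.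
Qed.

(** Jensen's inequality for [ln]: compare the graph with its tangent at the mean. *)
Lemma sum_ln_le_ln_sum (J : finType) (kappa t : J -> R) :
    (forall j, 0 <= kappa j) -> \sum_j kappa j = 1 -> (forall j, 0 < t j) ->
  \sum_j kappa j * ln (t j) <= ln (\sum_j kappa j * t j).
Proof.
move=> k0 k1 t0; set c := \sum_j kappa j * t j.
have c0 : 0 < c by exact: weighted_sum_gt0.
rewrite -subr_le0 -[X in _ - X]mulr1 -k1 mulr_sumr -sumrB.
apply: (@le_trans _ _ (\sum_j (kappa j * t j / c - kappa j))); last first.
  by rewrite sumrB k1 -mulr_suml mulfV ?subrr// gt_eqF.
apply: ler_sum => j _; have := @ln_le_subr1 (t j / c) (divr_gt0 (t0 j) c0).
rewrite ln_div ?posrE// => /(ler_wpM2l (k0 j)); lra.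
Qed.

(** Gibbs' inequality. Let [nu i] be the sum of [pi i j] over [j]. The weights
    [pi i j * v i * b j / nu i] have total mass at most 1: bounding [b j] by the
    mass of the cells [z] related to [j] and summing over [i] and [j] first
    leaves, for each [z], at most the sum of [v i] over the [i] charging some
    [j] related to [z]. Then [ln t <= t - 1] applies to the ratio of these
    weights to [pi]. Here [i] will be the itinerary of a point, [j] the cell
    containing it in a cover by Bowen balls, [b j] the measure of an enlarged
    ball, and [r j z] will say that this ball meets the cell [z]. *)
Lemma entropy_le_cross_sum (I J : finType) (pi : I -> J -> R) (u v : I -> R)
    (b : J -> R) (r : rel J) :
    (forall i j, 0 <= pi i j) -> \sum_i \sum_j pi i j = 1 ->
    (forall i, 0 < v i) -> (forall i, \sum_j pi i j <= u i) ->
    (forall j, 0 < b j) ->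
    (forall j, b j <= \sum_(z | r j z) \sum_i pi i z) ->
    (forall z, \sum_(i | [exists j, r j z && (0 < pi i j)]) v i <= 1) ->
  \sum_i \sum_j pi i j * (- ln (u i)) <=
  \sum_i \sum_j pi i j * (- ln (b j) - ln (v i)).
Proof.
move=> pi0 pi1 v0 hu b0 hb hv.
pose nu i := \sum_j pi i j; pose kappa z := \sum_i pi i z.
have nu0 i : 0 <= nu i by exact: sumr_ge0.
have kappa0 z : 0 <= kappa z by exact: sumr_ge0.
have kappa1 : \sum_z kappa z = 1 by rewrite exchange_big.
have key : \sum_i \sum_j pi i j * (v i * b j / nu i) <= 1.
  (* Replace b j by the mass of the cells related to j, then bring the sum over
     these cells to the front. *)
  apply: (@le_trans _ _ (\sum_i \sum_j \sum_(z | r j z)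
      (pi i j * (v i / nu i) * kappa z))).
    apply: ler_sum => i _; apply: ler_sum => j _.
    have -> : pi i j * (v i * b j / nu i) = pi i j * (v i / nu i) * b j.
      by rewrite -!mulrA [b j * _]mulrC.
    rewrite -mulr_sumr; apply: ler_wpM2l (hb j).
    by rewrite mulr_ge0 ?divr_ge0// ltW.
  rewrite exchange_big /=.
  under eq_bigr do rewrite exchange_big /=.
  under eq_bigr do rewrite big_mkcond /=.
  rewrite exchange_big /= -kappa1; apply: ler_sum => z _.
  rewrite -[leRHS]mulr1.
  apply: (@le_trans _ _ (kappa z *
     \sum_(i | [exists j, r j z && (0 < pi i j)]) v i)); last first.
    exact: ler_wpM2l (hv z).
  rewrite -big_mkcond /= exchange_big /= mulr_sumr [leRHS]big_mkcond /=.
  apply: ler_sum => i _; rewrite -mulr_suml -mulr_suml.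
  case: ifPn => [/existsP[j /andP[rjz pij]]|].
    have nui : 0 < nu i.
      by rewrite /nu (bigD1 j)//= ltr_pwDl// sumr_ge0.
    rewrite mulrC ler_wpM2l// mulrCA ger_pMr// ?v0// ler_pdivrMr// mul1r.
    by rewrite /nu [leRHS](bigID (r^~ z)) /= lerDl sumr_ge0.
  rewrite negb_exists => /forallP h; rewrite big1 ?mul0r// => j rjz.
  by apply/eqP; rewrite eq_le pi0 andbT leNgt; have := h j; rewrite rjz.
rewrite -subr_le0 -sumrB; apply: (@le_trans _ _
  (\sum_i \sum_j pi i j * (v i * b j / nu i) - \sum_i \sum_j pi i j)); last first.
  by rewrite pi1 subr_le0.
rewrite -sumrB; apply: ler_sum => i _; rewrite -!sumrB; apply: ler_sum => j _.
have := pi0 i j; rewrite le_eqVlt => /predU1P[<-|pij]; first by rewrite !mul0r.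
have nui : 0 < nu i by rewrite /nu (bigD1 j)//= ltr_pwDl// sumr_ge0.
have lnu : ln (nu i) <= ln (u i).
  by rewrite ler_ln ?posrE//; [exact: hu|exact: lt_le_trans nui (hu i)].
rewrite -mulrBr -[X in _ <= _ - X]mulr1 -mulrBr.
apply: ler_wpM2l; first exact: ltW.
have := @ln_le_subr1 (v i * b j / nu i) (divr_gt0 (mulr_gt0 (v0 i) (b0 j)) nui).
rewrite ln_div ?posrE ?mulr_gt0// lnM ?posrE//; lra.
Qed.

(** The letter [(j, s)] stands for the cell [j] of a partition, with [s] telling
    whether the point is in the exceptional set. The weights add up to 1 over the
    exceptional letters and any single other letter. *)
Definition cell_weight n (a : R) (c : 'I_n * bool) : R :=
  if c.2 then a / n%:R else 1 - a.

(** The sum over words factors into a product over the times [i]; each factor is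
    at most [a + (1 - a)], since [S i] has at most one ordinary letter. *)
Lemma sum_itinerary_weight_le1 n k (a : R) (S : 'I_k -> pred ('I_n * bool)) :
    0 <= a <= 1 ->
    (forall i j j', S i (j, false) -> S i (j', false) -> j = j') ->
  \sum_(c : {ffun 'I_k -> 'I_n * bool} | [forall i, S i (c i)])
    \prod_i cell_weight a (c i) <= 1.
Proof.
move=> /andP[a0 a1] hS.
have w0 c : 0 <= @cell_weight n a c.
  by rewrite /cell_weight; case: ifP => _; rewrite ?divr_ge0// subr_ge0.
have -> : \sum_(c : {ffun 'I_k -> 'I_n * bool} | [forall i, S i (c i)])
    \prod_i cell_weight a (c i) =
    \prod_(i < k) \sum_(c | S i c) cell_weight a c.
  rewrite bigA_distr_big_dep; apply: eq_bigl => c.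
  by apply/forallP/familyP => h i; have := h i.
apply: prodr_ile1 => i _; rewrite sumr_ge0//=.
rewrite (bigID (fun c => c.2)) /=.
have -> : 1 = a + (1 - a) :> R by rewrite addrC subrK.
apply: lerD.
  apply: (@le_trans _ _ (\sum_(c : 'I_n * bool | c.2) a / n%:R)).
    rewrite big_mkcond [leRHS]big_mkcond /=; apply: ler_sum => c _.
    rewrite /cell_weight; case: c.2; rewrite ?andbF// andbT; case: ifP => // _.
    by rewrite divr_ge0.
  rewrite (eq_bigl (fun c => true && (c.2 == true))); last first.
    by move=> c; rewrite eqb_id.
  rewrite -(pair_big xpredT (pred1 true) (fun _ _ => a / n%:R)) /=.
  under eq_bigr do rewrite big_pred1_eq.
  rewrite sumr_const card_ord.
  by case: n {S hS w0} => [|n]; rewrite ?mulr0n// -[_ *+ _]mulr_natr mulfVK.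
have [[j j2]|hno] := pselect (exists j, S i (j, false)).
  rewrite (eq_bigl (pred1 (j, false))) ?big_pred1_eq// => -[j' [|]] /=.
    by rewrite andbF xpair_eqE andbF.
  rewrite andbT xpair_eqE eqxx andbT; apply/idP/eqP => [h|->//].
  exact: hS h j2.
rewrite big1 ?subr_ge0// => -[j [|]] /andP[hj] // _.
by case: hno; exists j.
Qed.

End FiniteSums.

(** * Finite-valued random variables and integral bounds *)

Section ProbabilityTools.
Context {d : measure_display} {T : measurableType d} {R : realType}.
Variable mu : probability T R.

(** The integral of a nonnegative function is a supremum over the simple
    functions below it, hence is monotone for arbitrary functions. It is applied
    to the measure of a Bowen ball as a function of its center. *)
Lemma ge0_le_integral_nonmeas (f g : T -> \bar R) :
    (forall x, 0 <= f x)%E -> (forall x, f x <= g x)%E ->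
  (\int[mu]_x f x <= \int[mu]_x g x)%E.
Proof.
move=> f0 fg; have g0 x : (0 <= g x)%E by exact: le_trans (f0 x) (fg x).
rewrite !ge0_integralE//; apply: ereal_sup_le => _ [h /= hf <-].
exists h => //= x; apply: (le_trans (hf x)).
by rewrite !patch_setT.
Qed.

Lemma ge0_integral_le_cst_ae (f : T -> \bar R) (c : R) :
    (forall x, 0 <= f x)%E -> {ae mu, forall x, (f x <= c%:E)%E} ->
  (\int[mu]_x f x <= c%:E)%E.
Proof.
move=> f0 [N [mN N0 fN]].
have [x0 Nx0] : exists x, ~ N x.
  apply/existsNP => NT; have := probability_setT mu.
  rewrite (_ : setT = N); last by apply/seteqP; split.
  by rewrite N0 => /eqP; rewrite eq_sym onee_eq0.
have fc x : ~ N x -> (f x <= c%:E)%E.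
  by move=> Nx; apply: contrapT => h; apply: Nx; exact: fN.
have c0 : (0 <= c%:E)%E by exact: le_trans (f0 x0) (fc _ Nx0).
pose g x : \bar R := if x \in N then +oo%E else c%:E.
apply: (@le_trans _ _ (\int[mu]_x g x)%E).
  apply: ge0_le_integral_nonmeas => // x; rewrite /g.
  by case: ifPn => [_|]; [rewrite leey|rewrite notin_setE => /fc].
have mg : measurable_fun setT g.
  apply: measurable_fun_ifT => //; apply: (measurable_fun_bool true).
  rewrite setTI (_ : _ @^-1` _ = N)//; apply/seteqP.
  by split=> x; [exact: set_mem|exact: mem_set].
have <- : (\int[mu]_x (cst c%:E) x = c%:E)%E.
  by rewrite integral_cst// [X in (_ * X)%E]probability_setT mule1.
apply: ae_ge0_le_integral => //=.
  by move=> x _; rewrite /g; case: ifP => _ //; rewrite leey.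
exists N; split=> // x /= h; apply: contrapT => Nx; apply: h => _.
by rewrite /g ifF//; apply/negbTE; rewrite notin_setE.
Qed.

Lemma exists_small_of_bigcap0 (F : nat -> set T) (eta : R) :
    (forall n, measurable (F n)) -> (forall n, F n.+1 `<=` F n) ->
    \bigcap_n F n = set0 -> 0 < eta ->
  exists N, (mu (F N) <= eta%:E)%E.
Proof.
move=> mF dF F0 eta0.
have := @nonincreasing_cvg_mu _ _ _ mu F; rewrite F0 measure0.
have niF : nonincreasing_seq F.
  by apply/nonincreasing_seqP => n; apply/subsetPset; exact: dF.
have muF0 : (mu (F 0%N) < +oo)%E.
  by rewrite (le_lt_trans (probability_le1 _ _)) ?ltry.
move=> /(_ muF0 mF measurable0 niF) /(_ [set y | (y < eta%:E)%E]).
have /open_ereal_lt' h : (0 < eta%:E)%E by rewrite lte_fin.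
by move=> /(_ h) [N _ hN]; exists N; apply/ltW/hN => /=.
Qed.

Lemma measure_preimage_sum (I : finType) (F : T -> I) (Q : pred I) :
    (forall i, measurable [set x | F x = i]) ->
  (mu [set x | Q (F x)] = \sum_(i | Q i) mu [set x | F x = i])%E.
Proof.
move=> mF.
suff h (s : seq I) : uniq s -> measurable [set x | F x \in s] /\
    (mu [set x | F x \in s] = \sum_(i <- s) mu [set x | F x = i])%E.
  transitivity (\sum_(i <- enum Q) mu [set x | F x = i])%E; last first.
    by rewrite big_enum.
  rewrite -(h (enum Q) (enum_uniq Q)).2.
  by congr (mu _); apply/seteqP; split=> x /=; rewrite mem_enum.
elim: s => [_|i s IH /= /andP[si /IH[ms muE]]].
  by rewrite big_nil (_ : [set _ | _] = set0) ?measure0// -subset0 => x.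
have -> : [set x | F x \in i :: s] = [set x | F x = i] `|` [set x | F x \in s].
  apply/seteqP; split=> x /=; rewrite inE; first by case/predU1P; [left|right].
  by case=> [->|->]; rewrite ?eqxx ?orbT.
split; first exact: measurableU.
rewrite big_cons -muE; apply: measureU => //.
by rewrite -subset0 => x /= [->]; rewrite (negbTE si).
Qed.

Lemma fine_measure_preimage_sum (I : finType) (F : T -> I) (Q : pred I) :
    (forall i, measurable [set x | F x = i]) ->
  fine (mu [set x | Q (F x)]) = \sum_(i | Q i) fine (mu [set x | F x = i]).
Proof.
move=> mF; rewrite measure_preimage_sum// sum_fine// => i _.
exact: fin_num_measure.
Qed.

Lemma sum_le_integral (I : finType) (F : T -> I) (c : I -> R) (g : T -> \bar R) :
    (forall i, measurable [set x | F x = i]) -> (forall i, 0 <= c i) ->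
    (forall x, (c (F x))%:E <= g x)%E ->
  ((\sum_i fine (mu [set x | F x = i]) * c i)%:E <= \int[mu]_x g x)%E.
Proof.
move=> mF c0 cg; apply: le_trans (ge0_le_integral_nonmeas _ cg); last first.
  by move=> x; rewrite lee_fin.
have cE x : ((c (F x))%:E =
    \sum_(i <- index_enum I) (c i)%:E * (\1_[set x | F x = i] x)%:E)%E.
  rewrite (bigD1 (F x))//= indicE mem_set// mule1 big1 ?adde0// => i iFx.
  by rewrite indicE memNset ?mule0//= => /esym/eqP; apply/negP.
under eq_integral do rewrite cE.
rewrite ge0_integral_sum//; last 2 first.
- by move=> i; apply: measurable_funeM; exact/measurable_EFinP/measurable_indic.
- by move=> i x _; rewrite mule_ge0// lee_fin.
rewrite -sumEFin; apply: lee_sum => i _.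
rewrite ge0_integralZl_EFin//; last exact/measurable_EFinP/measurable_indic.
rewrite integral_indic// setIT mulrC EFinM fineK//.
exact: fin_num_measure.
Qed.

Lemma measurable_preimage_pred (I : finType) (Q : pred I) (F : T -> I) :
  (forall i, measurable [set x | F x = i]) -> measurable [set x | Q (F x)].
Proof.
move=> mF.
rewrite (_ : [set _ | _] = \bigcup_(i in [set i | Q i]) [set x | F x = i]).
  by apply: fin_bigcup_measurable => [|i _]; [exact: finite_finset|exact: mF].
by apply/seteqP; split=> x /= => [Qx|[i /= Qi ->]//]; exists (F x).
Qed.

Lemma sum_fine_measure_comp (I I' : finType) (F : T -> I) (q : I -> I')
    (h : I' -> R) :
    (forall i, measurable [set x | F x = i]) ->
  \sum_i fine (mu [set x | F x = i]) * h (q i) =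
  \sum_i' fine (mu [set x | q (F x) = i']) * h i'.
Proof.
move=> mF; rewrite (partition_big q predT)//=; apply: eq_bigr => i' _.
rewrite (_ : [set x | q (F x) = i'] = [set x | (fun i => q i == i') (F x)]).
  rewrite (fine_measure_preimage_sum (fun i => q i == i') mF) mulr_suml.
  by apply: eq_bigr => i /eqP ->.
by apply/seteqP; split=> x /= /eqP.
Qed.

Lemma sum_fine_measure_eq1 (I : finType) (F : T -> I) :
  (forall i, measurable [set x | F x = i]) ->
  \sum_i fine (mu [set x | F x = i]) = 1.
Proof.
move=> mF; rewrite -(fine_measure_preimage_sum xpredT mF).
rewrite (_ : [set _ | _] = setT) ?probability_setT//.
by apply/seteqP; split.
Qed.

Lemma fine_measure_le (A B : set T) : measurable A -> measurable B ->
  A `<=` B -> fine (mu A) <= fine (mu B).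
Proof.
move=> mA mB AB; apply: fine_le; rewrite ?fin_num_measure//.
by apply: le_measure; rewrite ?inE.
Qed.

Lemma cover_selection N (B : 'I_N -> set T) :
    (forall i, measurable (B i)) -> (forall x, exists i, B i x) ->
  exists psi : T -> 'I_N,
    (forall x, B (psi x) x) /\ (forall i, measurable [set x | psi x = i]).
Proof.
move=> mB covB.
have ex x : exists i, B i x /\ forall j : 'I_N, (j < i)%N -> ~ B j x.
  have [i0 Bi0] := covB x.
  pose i := [arg min_(i < i0 | `[< B i x >]) nat_of_ord i]%N.
  exists i; rewrite /i; case: arg_minnP => [|j /asboolP Bj jmin].
    exact/asboolP.
  split=> // i' i'j Bi'; have := jmin i'.
  by rewrite asboolT// leqNgt i'j => /(_ isT).
have [psi psiP] := choice ex.
exists psi; split=> [x|i]; first by have [] := psiP x.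
rewrite (_ : [set _ | _] = B i `\` \bigcup_(j in [set j : 'I_N | (j < i)%N]) B j).
  apply: measurableD => //.
  by apply: fin_bigcup_measurable => [|j _]; [exact: finite_finset|exact: mB].
apply/seteqP; split=> x /=.
  by move=> <-; have [? h] := psiP x; split=> // -[j /= ji]; exact: h.
move=> [Bi nB]; have [Bp h] := psiP x.
apply/val_inj; case: (ltngtP (psi x) i) => // [pi|ip]; last by case: (h _ ip).
by case: nB; exists (psi x).
Qed.

End ProbabilityTools.

Section FiniteCoordinates.
Context {m : nat}.

Lemma cylinder_measurable n (w : n.-tuple 'I_m.+1) :
  measurable (cylinder w : set (Sigma m)).
Proof. by apply: sub_sigma_algebra; exists n, w. Qed.

Definition agree_upto (k : nat) (w w' : Sigma m) :=
  forall i, (i < k)%N -> w i = w' i.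

(** Such a set is a union of cylinders of length [k], of which there are finitely
    many. All integrands over [Sigma m] below depend on finitely many
    coordinates. *)
Lemma finite_coordinates_measurable_set k (A : set (Sigma m)) :
    (forall w w', agree_upto k w w' -> A w -> A w') -> measurable A.
Proof.
move=> hA.
have -> : A = \bigcup_(t in
    [set t : k.-tuple 'I_m.+1 | exists2 w, A w & cylinder t w])
    (cylinder t : set (Sigma m)).
  apply/seteqP; split=> w.
    move=> Aw; exists [tuple w i | i < k]; last by move=> i; rewrite tnth_mktuple.
    by exists w => // i; rewrite tnth_mktuple.
  move=> [t [w' Aw' tw'] tw]; apply: hA Aw' => i ik.
  by have := tw (Ordinal ik); have := tw' (Ordinal ik) => /= -> ->.
apply: fin_bigcup_measurable => [|t _]; first exact: finite_finset.
exact: cylinder_measurable.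
Qed.

Lemma finite_coordinates_measurable d (S : measurableType d) k (g : Sigma m -> S) :
    (forall w w', agree_upto k w w' -> g w = g w') -> measurable_fun setT g.
Proof.
move=> hg _ B mB; rewrite setTI; apply: (@finite_coordinates_measurable_set k).
by move=> w w' /hg /= ->.
Qed.

End FiniteCoordinates.

(** * Almost uniform continuity of Borel partitions *)

Section BorelMetric.
Context {R : realType} {X : pointedMetricType R}.

Lemma open_mdist_lt (x : X) (r : R) : open [set y | mdist x y < r].
Proof.
rewrite openE => y /= xy; apply/nbhs_ballP; exists (r - mdist x y) => /=.
  by rewrite subr_gt0.
move=> z; rewrite ballEmdist/= => yz.
by rewrite (le_lt_trans (metric_triangle x y z))// -ltrBrDl.
Qed.

Lemma open_measurable_borel (U : set X) : open U -> measurable (U : set (borel X)).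
Proof. exact: sub_sigma_algebra. Qed.

Lemma closed_measurable_borel (C : set X) :
  closed C -> measurable (C : set (borel X)).
Proof.
move=> cC; rewrite -[C]setCK; apply: measurableC.
by apply: open_measurable_borel; exact: closed_openC.
Qed.

Lemma continuous_measurable_preimage (g : X -> X) (A : set (borel X)) :
  continuous g -> measurable A -> measurable (g @^-1` A : set (borel X)).
Proof.
move=> cg; move: A; apply: smallest_sub.
  split=> [|A mA|A mA].
  - by rewrite /= preimage_set0.
  - by rewrite /= setTD preimage_setC; exact: measurableC.
  - by rewrite /= preimage_bigcup; exact: bigcupT_measurable.
by move=> U oU; apply: open_measurable_borel; apply: open_comp.
Qed.

Variable mu : probability (borel X) R.

(** A form of Lusin's theorem for indicator functions: off [D], the indicator of
    [A] does not change over distances less than [rho]. *)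
Definition separable_off_small (A : set (borel X)) := forall eta : R, 0 < eta ->
  exists (D : set (borel X)) (rho : R),
    [/\ measurable D, (mu D <= eta%:E)%E, 0 < rho &
     forall x y : X, ~ D x -> ~ D y -> mdist x y < rho -> A x -> A y].

(** Remove from [U] the points at distance less than [1 / n] from its complement;
    these sets decrease to the empty set. *)
Lemma open_separable_off_small (U : set X) : open U -> separable_off_small U.
Proof.
move=> oU eta eta0.
pose F n : set (borel X) :=
  U `&` \bigcup_(y in ~` U) [set x : X | mdist y x < n.+1%:R^-1].
have mF n : measurable (F n).
  apply: open_measurable_borel; apply: openI => //.
  by apply: bigcup_open => y _; exact: open_mdist_lt.
have dF n : F n.+1 `<=` F n.
  move=> x [Ux [y Uy /= xy]]; split=> //; exists y => //=.
  by rewrite (lt_le_trans xy)// lef_pV2 ?posrE// ler_nat.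
have F0 : \bigcap_n F n = set0.
  rewrite -subset0 => x Fx; have [Ux _] := Fx 0%N I.
  move: oU; rewrite openE => /(_ x Ux) /nbhs_ballP[r /= r0].
  rewrite ballEmdist => rU.
  have [n rn] : exists n, n.+1%:R^-1 < r.
    have [N _ hN] := near_infty_natSinv_lt (PosNum r0).
    by exists N; exact: (hN N (leqnn N)).
  have [_ [y Uy /= xy]] := Fx n I; apply: Uy; apply: rU => /=.
  by rewrite metric_sym (lt_trans xy).
have [N hN] := exists_small_of_bigcap0 mu mF dF F0 eta0.
exists (F N), N.+1%:R^-1; split=> // x y Dx Dy xy Ux.
apply: contrapT => Uy; apply: Dx; split=> //; exists y => //=.
by rewrite metric_sym.
Qed.

(** The property defines a sigma-algebra: it is stable under complement because
    the distance is symmetric, and a countable union differs from a finite one by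
    a set of small measure, which is added to the exceptional set. *)
Lemma measurable_separable_off_small (A : set (borel X)) :
  measurable A -> separable_off_small A.
Proof.
move=> mA; suff: measurable A /\ separable_off_small A by case.
move: A mA; apply: smallest_sub; last first.
  move=> U oU; split; first exact: open_measurable_borel.
  exact: open_separable_off_small.
split.
- split=> // eta eta0; exists set0, 1; split=> //.
  by rewrite measure0 lee_fin ltW.
- move=> A [mA sA]; split; first exact: measurableD.
  move=> eta /sA[D [rho [mD Deta rho0 h]]]; exists D, rho; split=> //.
  move=> x y Dx Dy xy [_ Ax]; split=> // Ay; apply: Ax.
  by apply: h Ay => //; rewrite metric_sym.
move=> A hA; split; first by apply: bigcupT_measurable => n; exact: (hA n).1.
move=> eta eta0.
pose F n : set (borel X) := (\bigcup_k A k) `\` \bigcup_(k < n) A k.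
have mF n : measurable (F n).
  apply: measurableD; first by apply: bigcupT_measurable => k; exact: (hA k).1.
  by apply: fin_bigcup_measurable => [|k _]; [exact: finite_II|exact: (hA k).1].
have dF n : F n.+1 `<=` F n.
  move=> x [Ax nx]; split=> // -[k /= kn Akx]; apply: nx; exists k => //=.
  exact: ltnW.
have F0 : \bigcap_n F n = set0.
  rewrite -subset0 => x Fx; have [[k _ Akx] _] := Fx 0%N I.
  by have [_] := Fx k.+1 I; apply; exists k => /=.
have eta2 : 0 < eta / 2 by rewrite divr_gt0.
have [N hN] := exists_small_of_bigcap0 mu mF dF F0 eta2.
suff [D [rho [mD Deta rho0 h]]] : exists (D : set (borel X)) (rho : R),
    [/\ measurable D, (mu D <= (eta / 2)%:E)%E, 0 < rho &
     forall x y : X, ~ D x -> ~ D y -> mdist x y < rho ->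
       forall k, (k < N)%N -> A k x -> A k y].
  exists (D `|` F N), rho; split=> //; first exact: measurableU.
    by rewrite (le_trans (measureU2 _ mD (mF N)))// [eta]splitr EFinD leeD.
  move=> x y Dx Dy xy Ax.
  have [k kN Akx] : exists2 k, (k < N)%N & A k x.
    apply: contrapT => h'; apply: Dx; right; split=> //.
  exists k => //; apply: (h x y) => // ?; [apply: Dx|apply: Dy]; by left.
elim: N {hN} (eta / 2) eta2 => [e e0|N IH e e0].
  by exists set0, 1; split=> //; rewrite measure0 lee_fin ltW.
have e2 : 0 < e / 2 by rewrite divr_gt0.
have [D1 [r1 [mD1 De1 r10 h1]]] := IH _ e2.
have [D2 [r2 [mD2 De2 r20 h2]]] := (hA N).2 _ e2.
exists (D1 `|` D2), (Num.min r1 r2); split.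
- exact: measurableU.
- by rewrite (le_trans (measureU2 _ mD1 mD2))// [e]splitr EFinD leeD.
- by rewrite lt_min r10.
move=> x y Dx Dy; rewrite lt_min => /andP[xy1 xy2] k; rewrite ltnS leq_eqVlt.
case/predU1P => [->|kN].
  by apply: h2 => // ?; [apply: Dx|apply: Dy]; right.
by apply: (h1 x y) => // ?; [apply: Dx|apply: Dy]; left.
Qed.

Lemma partition_separable_off_small n (xi : 'I_n -> set (borel X)) (eta : R) :
    (forall i, measurable (xi i)) -> 0 < eta ->
  exists (D : set (borel X)) (rho : R),
    [/\ measurable D, (mu D <= eta%:E)%E, 0 < rho &
     forall x y : X, ~ D x -> ~ D y -> mdist x y < rho ->
       forall i, xi i x -> xi i y].
Proof.
move=> mxi eta0.
suff /(_ (enum 'I_n)) [D [rho [mD Deta rho0 h]]] : forall s : seq 'I_n,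
    exists (D : set (borel X)) (rho : R),
    [/\ measurable D, (mu D <= eta%:E)%E, 0 < rho &
     forall x y : X, ~ D x -> ~ D y -> mdist x y < rho ->
       forall i, i \in s -> xi i x -> xi i y].
  exists D, rho; split=> // x y Dx Dy xy i; apply: (h x y) => //.
  by rewrite mem_enum.
move=> s; elim: s eta eta0 => [e e0|i s IH e e0].
  by exists set0, 1; split=> //; rewrite measure0 lee_fin ltW.
have e2 : 0 < e / 2 by rewrite divr_gt0.
have [D1 [r1 [mD1 De1 r10 h1]]] := IH _ e2.
have [D2 [r2 [mD2 De2 r20 h2]]] := measurable_separable_off_small (mxi i) e2.
exists (D1 `|` D2), (Num.min r1 r2); split.
- exact: measurableU.
- by rewrite (le_trans (measureU2 _ mD1 mD2))// [e]splitr EFinD leeD.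
- by rewrite lt_min r10.
move=> x y Dx Dy; rewrite lt_min => /andP[xy1 xy2] k; rewrite inE.
case/predU1P => [->|kN].
  by apply: h2 => // ?; [apply: Dx|apply: Dy]; right.
by apply: (h1 x y) => // ?; [apply: Dx|apply: Dy]; left.
Qed.

End BorelMetric.

(** * Bowen metrics along a word *)

Section BowenGeometry.
Context {R : realType} {X : pointedMetricType R} {m : nat}.
Variable f : 'I_m.+1 -> X -> X.
Implicit Types (w : Sigma m) (k : nat) (x y : X) (e : R).

Lemma mdist_le_bowen_dist w k x y i : (i < k)%N ->
  mdist (fiter f w i x) (fiter f w i y) <= bowen_dist f w k x y.
Proof. by move=> ik; rewrite /bowen_dist (le_bigmax _ _ (Ordinal ik)). Qed.

Lemma bowen_distP w k x y e : 0 <= e ->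
  reflect (forall i, (i < k)%N -> mdist (fiter f w i x) (fiter f w i y) <= e)
          (bowen_dist f w k x y <= e).
Proof.
move=> e0; apply: (iffP idP) => [h i ik|h].
  by apply: le_trans h; exact: mdist_le_bowen_dist.
by apply/bigmax_leP; split=> // i _; exact: h.
Qed.

Lemma bowen_dist_ge0 w k x y : 0 <= bowen_dist f w k x y.
Proof. exact: bigmax_ge_id. Qed.

Lemma bowen_dist_sym w k x y : bowen_dist f w k x y = bowen_dist f w k y x.
Proof. by apply: eq_bigr => i _; rewrite metric_sym. Qed.

Lemma bowen_distxx w k x : bowen_dist f w k x x = 0.
Proof.
apply/le_anti; rewrite bowen_dist_ge0 andbT.
by apply/bowen_distP => // i _; rewrite mdistxx.
Qed.

Lemma bowen_dist_triangle w k x y z :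
  bowen_dist f w k x z <= bowen_dist f w k x y + bowen_dist f w k y z.
Proof.
apply/bowen_distP => [|i ik]; first by rewrite addr_ge0 ?bowen_dist_ge0.
apply: le_trans (metric_triangle _ (fiter f w i y) _) _.
by apply: lerD; exact: mdist_le_bowen_dist.
Qed.

Lemma fiter_agree k w w' : agree_upto k w w' ->
  forall i, (i <= k)%N -> fiter f w i = fiter f w' i.
Proof.
move=> ww'; elim=> [//|i IH ik] /=.
by rewrite ww'// IH// ltnW.
Qed.

Lemma bowen_dist_agree k w w' : agree_upto k w w' ->
  bowen_dist f w k = bowen_dist f w' k.
Proof.
move=> ww'; apply/funext => x; apply/funext => y; apply: eq_bigr => i _.
by rewrite (fiter_agree ww')// ltnW.
Qed.

Lemma bowen_ball_agree k w w' : agree_upto k w w' ->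
  bowen_ball f w k = bowen_ball f w' k.
Proof.
move=> ww'; apply/funext => x; apply/funext => e.
by rewrite /bowen_ball (bowen_dist_agree ww').
Qed.

Hypothesis fcont : forall i, continuous (f i).

Lemma fiter_continuous w i : continuous (fiter f w i).
Proof.
elim: i => [|i IH] /= x; first exact: cvg_id.
by apply: continuous_comp; [exact: IH|exact: fcont].
Qed.

(** The strict inequalities give an open set, which is why Bowen balls have
    positive measure. *)
Lemma open_bowen_lt w k x e : open [set y | forall i, (i < k)%N ->
   mdist (fiter f w i x) (fiter f w i y) < e].
Proof.
elim: k => [|k IH].
  by rewrite (_ : [set _ | _] = setT); [exact: openT|apply/seteqP; split].
rewrite (_ : [set _ | _] = [set y | forall i, (i < k)%N ->
   mdist (fiter f w i x) (fiter f w i y) < e] `&`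
   fiter f w k @^-1` [set z | mdist (fiter f w k x) z < e]); last first.
  apply/seteqP; split=> y.
    by move=> h; split=> [i ik|]; apply: h; rewrite // ltnW.
  by move=> [h hk] i; rewrite ltnS leq_eqVlt => /predU1P[->//|]; exact: h.
apply: openI => //.
by apply: open_comp => [y _|]; [exact: fiter_continuous|exact: open_mdist_lt].
Qed.

Lemma bowen_ball_measurable w k x e :
  0 <= e -> measurable (bowen_ball f w k x e : set (borel X)).
Proof.
move=> e0.
rewrite (_ : bowen_ball _ _ _ _ _ = \bigcap_(i in `I_k)
   fiter f w i @^-1` [set z | mdist (fiter f w i x) z <= e]); last first.
  by apply/seteqP; split=> y /(bowen_distP _ _ _ _ e0).
apply: bigcap_measurableType => i _; apply: continuous_measurable_preimage.
  exact: fiter_continuous.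
apply: closed_measurable_borel.
rewrite -[X in closed X]setCK; apply: open_closedC.
rewrite openE => y /= /negP; rewrite -ltNge => xy.
apply/nbhs_ballP; exists (mdist (fiter f w i x) y - e) => /=.
  by rewrite subr_gt0.
move=> z; rewrite ballEmdist/= => yz; apply/negP; rewrite -ltNge.
have := metric_triangle (fiter f w i x) z y; rewrite (metric_sym z y); lra.
Qed.

Variable mu : probability (borel X) R.

Lemma bowen_ball_gt0 w k x e : full_support mu -> 0 < e ->
  0 < fine (mu (bowen_ball f w k x e)).
Proof.
move=> mufull e0; rewrite -lte_fin fineK; last first.
  by apply: fin_num_measure; apply: bowen_ball_measurable; exact: ltW.
apply: (@lt_le_trans _ _ (mu [set y | forall i, (i < k)%N ->
   mdist (fiter f w i x) (fiter f w i y) < e])).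
  apply: mufull; first exact: open_bowen_lt.
  by exists x => i _; rewrite mdistxx.
apply: le_measure; rewrite ?inE.
- exact: (open_measurable_borel (open_bowen_lt _ _ _ _)).
- by apply: bowen_ball_measurable; exact: ltW.
by move=> y /= h; apply/bowen_distP => [|i ik]; rewrite ltW// h.
Qed.

Variable P : probability (Sigma m) R.

(** The cocycle identity: it makes the sets [S n] of
    [integral_measure_fiter_preimage] successive preimages under the skew
    product. *)
Lemma fiter_shift w n x : fiter f (Defs.shift w) n (f (w 0%N) x) = fiter f w n.+1 x.
Proof. by elim: n => [//|n IH] /=; rewrite IH. Qed.

Lemma fiter_preimage_measurable n (U : set (borel X)) : measurable U ->
  measurable [set z : Sigma m * borel X | U (fiter f z.1 n z.2)].
Proof.
move=> mU.
rewrite (_ : [set _ | _] = \bigcup_(t in [set: n.-tuple 'I_m.+1])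
   ((cylinder t : set (Sigma m)) `*`
    (fiter f (fun i => nth ord0 t i) n @^-1` U : set (borel X)))); last first.
  apply/seteqP; split=> -[w x] /=.
    move=> Uw; exists [tuple w i | i < n] => //; split=> /=.
      by move=> i; rewrite tnth_mktuple.
    rewrite (@fiter_agree n _ w)// => i ini.
    have := tnth_nth ord0 [tuple w i | i < n] (Ordinal ini).
    by rewrite tnth_mktuple => /esym.
  move=> [t _ [/= tw]]; rewrite (@fiter_agree n _ w)// => i ini.
  by have := tw (Ordinal ini) => /= ->; rewrite (tnth_nth ord0).
apply: fin_bigcup_measurable => [|t _]; first exact: finite_finset.
apply: measurableX; first exact: cylinder_measurable.
by apply: continuous_measurable_preimage => //; exact: fiter_continuous.
Qed.

(** The integral is the product measure of the set [S n] of the [(w, x)] with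
    [fiter f w n x] in [U], and [S n.+1] is the preimage of [S n] under the skew
    product. *)
Lemma integral_measure_fiter_preimage n (U : set (borel X)) :
    G_invariant f P mu -> measurable U ->
  (\int[P]_w mu (fiter f w n @^-1` U) = mu U)%E.
Proof.
move=> muG mU.
pose S n : set (Sigma m * borel X) := [set z | U (fiter f z.1 n z.2)].
have -> : (\int[P]_w mu (fiter f w n @^-1` U) = (P \x mu) (S n))%E.
  rewrite /product_measure1 /=; apply: eq_integral => w _ /=.
  by congr (mu _); apply/seteqP; split=> x; rewrite /xsection/= inE.
have -> : (P \x mu)%E (S n) = (P \x mu)%E (S 0%N).
  elim: n => [//|n <-]; rewrite -(muG (S n)); last exact: fiter_preimage_measurable.
  congr ((P \x mu)%E _); apply/seteqP; split=> -[w x];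
    by rewrite /S /skew_product /= fiter_shift.
rewrite (_ : S 0%N = setT `*` U); last first.
  by apply/seteqP; split=> -[w x] //= [].
rewrite product_measure1E//.
by rewrite [X in (X * _)%E]probability_setT mul1e.
Qed.

End BowenGeometry.

(** * Entropy of a join against a cover by Bowen balls *)

Section FiberwiseEntropy.
Context {R : realType} {X : pointedMetricType R} {m : nat}.
Variables (f : 'I_m.+1 -> X -> X) (mu : probability (borel X) R).
Hypothesis fcont : forall i, continuous (f i).
Hypothesis mufull : full_support mu.
Variables (w : Sigma m) (k : nat).

Definition join_measure n (xi : 'I_n -> set (borel X))
    (a : {ffun 'I_k -> 'I_n}) : R :=
  fine (mu (partition_join f xi w a)).

(** Partitions are handled through the function mapping a point to the index of
    its cell, so that itineraries become words. *)
Lemma partition_label n (xi : 'I_n -> set (borel X)) : measurable_partition xi ->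
  exists l : X -> 'I_n, forall i x, xi i x <-> l x = i.
Proof.
move=> [_ txi cxi].
have ex (x : X) : exists i, xi i x.
  by have : [set: borel X] x by []; rewrite -cxi => -[i _ ?]; exists i.
have [l lP] := choice ex; exists l => i x; split=> [xix|<-//].
by apply: (txi (l x) i) => //; exists x.
Qed.

Lemma partition_join_measurable n (xi : 'I_n -> set (borel X))
    (a : {ffun 'I_k -> 'I_n}) :
  measurable_partition xi -> measurable (partition_join f xi w a).
Proof.
move=> [mxi _ _].
apply: fin_bigcap_measurable => [|i _]; first exact: finite_finset.
by apply: continuous_measurable_preimage => //; exact: fiter_continuous.
Qed.

Lemma partition_entropyE n (xi : 'I_n -> set (borel X)) : measurable_partition xi ->
  partition_entropy mu (@partition_join _ _ _ f n xi w k) =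
  (\sum_a join_measure xi a * - ln (join_measure xi a))%:E.
Proof.
move=> pxi; rewrite /partition_entropy.
rewrite (eq_bigr (fun a => (join_measure xi a * ln (join_measure xi a))%:E)).
  rewrite sumEFin -EFinN -sumrN; congr EFin.
  by apply: eq_bigr => a _; rewrite mulrN.
move=> a _; have fa : mu (partition_join f xi w a) \is a fin_num.
  by apply: fin_num_measure; exact: partition_join_measurable.
have := fine_ge0 (measure_ge0 mu (partition_join f xi w a)).
rewrite -[in LHS](fineK fa) -/(join_measure xi a) le_eqVlt => /predU1P[<-|n0].
  by rewrite mul0e mul0r.
by rewrite lne_EFin.
Qed.

Section Cover.
Variables (n : nat) (xi : 'I_n -> set (borel X)) (D : set (borel X)) (rho a e : R).
Hypothesis pxi : measurable_partition xi.
Hypothesis mD : measurable D.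
Hypothesis sepD : forall x y : X, ~ D x -> ~ D y -> mdist x y < rho ->
  forall i, xi i x -> xi i y.
Hypothesis a01 : 0 < a < 1.
Hypothesis e0 : 0 < e.
Hypothesis e_rho : 8 * e < rho.
Variables (N : nat) (Y : 'I_N -> X) (psi : borel X -> 'I_N).
Hypothesis psiP : forall x, bowen_dist f w k (Y (psi x)) x <= e.
Hypothesis mpsi : forall j, measurable [set x | psi x = j].

(** [entropy_le_cross_sum] for the itinerary with respect to the letters
    (cell of [xi], membership in [D]) and the cell of the cover. If the ball of
    radius [2 * e] around [Y j] meets the cell [z], then the cell [j] is within
    [4 * e] of [Y z]; two points of such cells, both off [D] at some time, are
    then less than [rho] apart at that time, so they share their cell of [xi]: the words met by
    the cells related to [z] have total weight at most 1. *)
Lemma join_entropy_le_cover_sum :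
  \sum_c join_measure xi c * - ln (join_measure xi c) <=
  \sum_j fine (mu [set x | psi x = j]) *
         - ln (fine (mu (bowen_ball f w k (Y j) (2 * e)))) +
  \sum_(i < k) (fine (mu (fiter f w i @^-1` D)) * (ln n%:R - ln a) - ln (1 - a)).
Proof.
have /andP[a0 a1] := a01.
have e20 : 0 <= 2 * e by rewrite mulr_ge0// ltW.
have [l lP] := partition_label pxi.
have mxi i : measurable (xi i) by case: pxi.
have n0 : (0 < n)%N by apply: leq_ltn_trans (ltn_ord (l point)).
pose T i := fiter f w i.
pose word := {ffun 'I_k -> 'I_n * bool}.
pose cell i (x : borel X) : 'I_n * bool := (l (T i x), `[< D (T i x) >]).
have mcell i c : measurable [set x | cell i x = c].
  case: c => j b.
  rewrite (_ : [set _ | _] = T i @^-1` xi j `&` T i @^-1` (if b then D else ~` D)).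
    apply: measurableI; apply: continuous_measurable_preimage => //.
    - exact: fiter_continuous.
    - exact: fiter_continuous.
    - by case: b => //; exact: measurableC.
  apply/seteqP; split=> x /=.
    move=> [/lP ? <-]; split=> //; case: asboolP => //.
  move=> [/lP lx Db]; rewrite /cell lx; congr pair.
  by case: b Db => h; [exact: asboolT|exact: asboolF].
pose F (x : borel X) : word * 'I_N := ([ffun i : 'I_k => cell i x], psi x).
have mF p : measurable [set x | F x = p].
  case: p => c j.
  rewrite (_ : [set _ | _] =
      (\bigcap_(i in [set: 'I_k]) [set x | cell i x = c i]) `&`
      [set x | psi x = j]).
    apply: measurableI => //; apply: fin_bigcap_measurable => [|i _].
      exact: finite_finset.
    exact: mcell.
  apply/seteqP; split=> x /=.
    by move=> [<- <-]; split=> // i _ /=; rewrite ffunE.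
  by move=> [h <-]; congr pair; apply/ffunP => i; rewrite ffunE h.
pose pi c j := fine (mu [set x | F x = (c, j)]).
pose itin (c : word) : {ffun 'I_k -> 'I_n} := [ffun i => (c i).1].
pose v (c : word) : R := \prod_i cell_weight a (c i).
have w0 (c : 'I_n * bool) : 0 < cell_weight a c.
  by rewrite /cell_weight; case: ifP => _; rewrite ?subr_gt0// divr_gt0// ltr0n.
have v0 c : 0 < v c by apply: prodr_gt0 => i _.
pose b j := fine (mu (bowen_ball f w k (Y j) (2 * e))).
pose r : rel 'I_N := fun j z =>
  `[< exists x, psi x = z /\ bowen_dist f w k (Y j) x <= 2 * e >].
have joinE c : [set x | itin (F x).1 = c] = partition_join f xi w c.
  apply/seteqP; split=> x /=.
    by move=> <- i _ /=; apply/lP; rewrite !ffunE.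
  by move=> h; apply/ffunP => i; rewrite !ffunE /=; apply/lP; exact: h.
have pairE (H : word * 'I_N -> R) :
    \sum_c \sum_j pi c j * H (c, j) = \sum_p fine (mu [set x | F x = p]) * H p.
  by rewrite pair_bigA /=; apply: eq_bigr => -[c j] _.
(* The finer join with the flags refines the join of xi: its cells are smaller,
   and the inequality holds with the measures of the latter on the left. *)
have main : \sum_c \sum_j pi c j * - ln (join_measure xi (itin c)) <=
    \sum_c \sum_j pi c j * (- ln (b j) - ln (v c)).
  apply: (@entropy_le_cross_sum R _ _ pi _ v b r) => //.
  - by move=> c j; exact: fine_ge0.
  - have := pairE (fun=> 1); rewrite -[RHS]mulr_suml.
    under eq_bigr do under eq_bigr do rewrite mulr1.
    by rewrite mulr1 sum_fine_measure_eq1.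
  - move=> c.
    rewrite (_ : \sum_j pi c j = fine (mu [set x | (pred1 c \o fst) (F x)])).
      apply: fine_measure_le.
      + by apply: (measurable_preimage_pred (pred1 c \o fst) mF).
      + exact: partition_join_measurable.
      + by rewrite -joinE => x /= /eqP ->.
    rewrite (fine_measure_preimage_sum mu (pred1 c \o fst) mF).
    rewrite (sum_pair_cond (QI := pred1 c) (QJ := predT)
      (fun p => fine (mu [set x | F x = p]))) ?big_pred1_eq// => p.
    by rewrite /= andbT.
  - by move=> j; apply: bowen_ball_gt0 => //; rewrite mulr_gt0.
  - move=> j; rewrite exchange_big /=.
    rewrite -(sum_pair_cond (QI := predT) (QJ := r j)
      (fun p => fine (mu [set x | F x = p])) (Q := r j \o snd))//.
    rewrite -(fine_measure_preimage_sum mu (r j \o snd) mF).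
    apply: fine_measure_le; first exact: bowen_ball_measurable.
      exact: (measurable_preimage_pred (r j \o snd) mF).
    by move=> x /= dx; apply/asboolP; exists x.
  - move=> z; apply: le_trans (sum_itinerary_weight_le1 (n := n) (k := k) (a := a)
      (S := fun i c =>
         `[< exists x, bowen_dist f w k (Y z) x <= 4 * e /\ cell i x = c >]) _ _).
    + rewrite [leLHS]big_mkcond [leRHS]big_mkcond /=; apply: ler_sum => c _.
      case: ifPn => [/existsP[j /andP[/asboolP[x' [x'z rx']] pij]]|_]; last first.
        by case: ifP => // _; exact: (ltW (v0 c)).
      have [x Fx] : exists x, F x = (c, j).
        apply: contrapT => nex; move: pij; rewrite /pi.
        rewrite (_ : [set x | F x = _] = set0) ?measure0/= ?ltxx//.
        by rewrite -subset0 => x ?; apply: nex; exists x.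
      rewrite ifT//; apply/forallP => i; apply/asboolP; exists x.
      move: Fx => [cx jx]; split; last by rewrite -cx ffunE.
      have := bowen_dist_triangle f w k (Y z) x' x.
      have := bowen_dist_triangle f w k x' (Y j) x.
      have := psiP x'; have := psiP x; rewrite x'z jx.
      rewrite (bowen_dist_sym f w k x' (Y j)); lra.
    + by rewrite !ltW.
    + move=> i j j' /asboolP[x [dx [<- Dx]]] /asboolP[x' [dx' [<- Dx']]].
      apply/lP; apply: (sepD (x := T i x') (y := T i x)); last exact/lP.
      * by move=> h; move: Dx'; rewrite asboolT.
      * by move=> h; move: Dx; rewrite asboolT.
      apply: le_lt_trans e_rho.
      apply: le_trans (mdist_le_bowen_dist f w _ _ (ltn_ord i)) _.
      have := bowen_dist_triangle f w k x' (Y z) x.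
      rewrite (bowen_dist_sym f w k x' (Y z)); lra.
rewrite (pairE (fun p => - ln (join_measure xi (itin p.1)))) in main.
rewrite (pairE (fun p => - ln (b p.2) - ln (v p.1))) in main.
rewrite (sum_fine_measure_comp mu (fun p => itin p.1)
  (fun c => - ln (join_measure xi c)) mF) in main.
rewrite (eq_bigr (fun p => fine (mu [set x | F x = p]) * - ln (b p.2) +
  fine (mu [set x | F x = p]) * - ln (v p.1))) in main; last first.
  by move=> p _; rewrite mulrDr.
rewrite big_split /= in main.
rewrite (sum_fine_measure_comp mu snd (fun j => - ln (b j)) mF) in main.
have E1 : \sum_c fine (mu [set x | itin (F x).1 = c]) * - ln (join_measure xi c) =
    \sum_c join_measure xi c * - ln (join_measure xi c).
  by apply: eq_bigr => c _; rewrite joinE.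
rewrite E1 in main; apply: (le_trans main); rewrite lerD2l.
have lnv c : - ln (v c) = \sum_(i < k) - ln (cell_weight a (c i)).
  by rewrite sumrN /v ln_prod.
under eq_bigr do rewrite lnv mulr_sumr.
(* At each time, a letter costs L2, plus L1 when the point is in D. *)
rewrite exchange_big /=; apply: ler_sum => i _.
pose L1 := ln n%:R - ln a; pose L2 := - ln (1 - a).
have L20 : 0 <= L2 by rewrite oppr_ge0 ln_le0// gerBl ltW.
apply: (@le_trans _ _ (\sum_p fine (mu [set x | F x = p]) *
   (((p.1 i).2)%:R * L1 + L2))).
  apply: ler_sum => p _; rewrite ler_wpM2l ?fine_ge0//.
  rewrite /cell_weight; case: (p.1 i).2; last by rewrite mul0r add0r.
  by rewrite mul1r ln_div ?posrE ?ltr0n// opprB lerDl.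
under eq_bigr do rewrite mulrDr.
rewrite big_split /= -mulr_suml sum_fine_measure_eq1// mul1r lerD2r.
rewrite (sum_fine_measure_comp mu (fun p : word * 'I_N => (p.1 i).2)
  (fun b => b%:R * L1) mF).
rewrite big_bool /= mul0r mulr0 addr0 mul1r.
rewrite (_ : [set x | _ = true] = T i @^-1` D)//.
by apply/seteqP; split=> x /=; rewrite ffunE => /asboolP.
Qed.

End Cover.

End FiberwiseEntropy.

(** * Entropy of a join against moments and separated sets *)

Section FiberBounds.
Context {R : realType} {X : pointedMetricType R} {m : nat}.
Variables (f : 'I_m.+1 -> X -> X) (mu : probability (borel X) R).
Hypothesis fcont : forall i, continuous (f i).
Hypothesis mufull : full_support mu.
Variables (w : Sigma m) (k : nat).

Lemma compact_bowen_cover (e : R) : compact [set: X] -> 0 < e ->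
  exists N (Y : 'I_N -> X), forall x, exists j, bowen_dist f w k (Y j) x <= e.
Proof.
rewrite compact_cover => cX e0.
have [|x _|E _ cE] := cX _ [set: X] (fun y => [set x | forall i, (i < k)%N ->
   mdist (fiter f w i y) (fiter f w i x) < e]).
- by move=> y _; exact: open_bowen_lt.
- by exists x => // i _; rewrite mdistxx.
exists (size E), (fun i => nth point E i) => x.
have [y /= yE yx] := cE x I.
have iE : (index y E < size E)%N by rewrite index_mem.
exists (Ordinal iE); rewrite /= nth_index//.
by apply/bowen_distP => [|i ik]; [exact: ltW|exact/ltW/yx].
Qed.

(** A separated set that cannot be enlarged has covering balls; if every
    separated set can be enlarged, there are some of any size. *)
Lemma sep_card_ge_cover (e : R) : 0 <= e ->
  sep_card f w k e = +oo%E \/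
  exists N (Y : 'I_N -> X), (forall x, exists j, bowen_dist f w k (Y j) x <= e) /\
    ((N%:R)%:E <= sep_card f w k e)%E.
Proof.
move=> e0.
have [[E [sE nE]]|ext] := pselect (exists E : {fset X}, separated_set f w k e E /\
    ~ exists x, forall y, y \in E -> e < bowen_dist f w k y x).
  right; exists #|` E|, (fun i => nth point E i); split; last first.
    by apply: ereal_sup_ubound; exists E.
  move=> x; apply: contrapT => nx; apply: nE; exists x => y yE.
  rewrite ltNge; apply/negP => yx; apply: nx.
  have iE : (index y E < size E)%N by rewrite index_mem.
  by exists (@Ordinal #|` E| _ iE); rewrite /= nth_index.
left.
have big n : exists E : {fset X}, separated_set f w k e E /\ #|` E| = n.
  elim: n => [|n [E [sE En]]]; first by exists fset0; split=> // x y; rewrite inE.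
  have [x xE] : exists x, forall y, y \in E -> e < bowen_dist f w k y x.
    by apply: contrapT => nx; apply: ext; exists E.
  have xnE : x \notin E.
    by apply/negP => /xE; rewrite bowen_distxx ltNge e0.
  exists (x |` E)%fset; split; last by rewrite cardfsU1 xnE En.
  move=> y z /fset1UP[->|yE] /fset1UP[->|zE]; rewrite ?eqxx// => yz.
  - by rewrite bowen_dist_sym xE.
  - exact: xE.
  - exact: sE.
apply/eqyP => r r0.
have [E [sE En]] := big (Num.truncn r).+1.
apply: (@le_trans _ _ (#|` E|%:R)%:E); last by apply: ereal_sup_ubound; exists E.
by rewrite lee_fin En ltW// Num.Theory.truncnS_gt.
Qed.

Variables (n : nat) (xi : 'I_n -> set (borel X)) (D : set (borel X)) (rho a e : R).
Hypothesis pxi : measurable_partition xi.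
Hypothesis mD : measurable D.
Hypothesis sepD : forall x y : X, ~ D x -> ~ D y -> mdist x y < rho ->
  forall i, xi i x -> xi i y.
Hypothesis a01 : 0 < a < 1.
Hypothesis e0 : 0 < e.
Hypothesis e_rho : 8 * e < rho.

Let err : R :=
  \sum_(i < k) (fine (mu (fiter f w i @^-1` D)) * (ln n%:R - ln a) - ln (1 - a)).

(** For [x] in the cell of [Y j], the ball around [x] is included in the ball of
    radius [2 * e] around [Y j]; its measure to the negative power [q - 1] is thus
    bounded below by a function with finitely many values, to which Jensen's
    inequality applies. *)
Lemma partition_entropy_le_moment (q : R) : compact [set: X] -> q <= 0 ->
  (partition_entropy mu (@partition_join _ _ _ f n xi w k) <=
  ((1 - q)^-1)%:E * lne (\int[mu]_x (mu (bowen_ball f w k x e) `^ (q - 1))) +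
  err%:E)%E.
Proof.
move=> cX q0; rewrite partition_entropyE//.
have e20 : 0 <= 2 * e by rewrite mulr_ge0// ltW.
have q1 : 0 < 1 - q by rewrite subr_gt0 (le_lt_trans q0).
have [N [Y cY]] := compact_bowen_cover cX e0.
have [psi [psiP mpsi]] := @cover_selection _ (borel X) N
  (fun j => bowen_ball f w k (Y j) e)
  (fun j => bowen_ball_measurable fcont _ _ _ (ltW e0)) cY.
have main := join_entropy_le_cover_sum fcont mufull pxi mD sepD a01 e0 e_rho
  psiP mpsi.
pose b j := fine (mu (bowen_ball f w k (Y j) (2 * e))).
pose kap j := fine (mu [set x | psi x = j]).
have b0 j : 0 < b j by apply: bowen_ball_gt0 => //; rewrite mulr_gt0.
have kap0 j : 0 <= kap j by exact: fine_ge0.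
have kap1 : \sum_j kap j = 1 by exact: sum_fine_measure_eq1.
pose S := \sum_j kap j * b j `^ (q - 1).
have SM : (S%:E <= \int[mu]_x (mu (bowen_ball f w k x e) `^ (q - 1)))%E.
  apply: sum_le_integral => // [j|x]; first exact: powR_ge0.
  have mB : measurable (bowen_ball f w k x e : set (borel X)).
    by apply: bowen_ball_measurable => //; exact: ltW.
  rewrite -[mu _]fineK ?fin_num_measure// poweR_EFin lee_fin.
  apply: powR_le0_antitone; first lra.
    exact: bowen_ball_gt0.
  apply: fine_measure_le => //; first exact: bowen_ball_measurable.
  move=> y /= xy; apply: le_trans (bowen_dist_triangle _ _ _ _ x _) _.
  have xY : bowen_dist f w k (Y (psi x)) x <= e := psiP x.
  rewrite /bowen_ball /= in xy; lra.
have S0 : 0 < S.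
  by apply: weighted_sum_gt0 => // j; exact: powR_gt0.
apply: (@le_trans _ _ ((\sum_j kap j * - ln (b j))%:E + err%:E)%E).
  by rewrite -EFinD lee_fin.
rewrite leeD2r//; apply: (@le_trans _ _ ((1 - q)^-1%:E * lne S%:E)%E); last first.
  rewrite lee_wpmul2l ?lee_fin ?invr_ge0 ?(ltW q1)// lee_lne// in_itv/= leey andbT.
    by rewrite lee_fin ltW.
  by rewrite (le_trans _ SM)// lee_fin ltW.
rewrite lne_EFin// -EFinM lee_fin ler_pdivlMl//.
apply: le_trans (sum_ln_le_ln_sum kap0 kap1 (fun j => powR_gt0 _ (b0 j))).
rewrite mulr_sumr; apply: ler_sum => j _; rewrite ln_powR; lra.
Qed.

(** The case of a cover by a maximal separated set: by Jensen's inequality the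
    cover sum is at most the logarithm of the sum over [j] of [kap j / b j], whose
    terms are at most 1. *)
Lemma partition_entropy_le_sep_card :
  (partition_entropy mu (@partition_join _ _ _ f n xi w k) <=
  lne (sep_card f w k e) + err%:E)%E.
Proof.
rewrite partition_entropyE//.
have e20 : 0 < 2 * e by rewrite mulr_gt0.
have [->|[N [Y [cY Nsep]]]] := sep_card_ge_cover (ltW e0); first by rewrite /= leey.
have [psi [psiP mpsi]] := @cover_selection _ (borel X) N
  (fun j => bowen_ball f w k (Y j) e)
  (fun j => bowen_ball_measurable fcont _ _ _ (ltW e0)) cY.
have main := join_entropy_le_cover_sum fcont mufull pxi mD sepD a01 e0 e_rho
  psiP mpsi.
pose b j := fine (mu (bowen_ball f w k (Y j) (2 * e))).
pose kap j := fine (mu [set x | psi x = j]).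
have b0 j : 0 < b j by exact: bowen_ball_gt0.
have kap1 : \sum_j kap j = 1 by exact: sum_fine_measure_eq1.
have N0 : (0 < N)%N by apply: leq_ltn_trans (ltn_ord (psi point)).
apply: (@le_trans _ _ ((\sum_j kap j * - ln (b j))%:E + err%:E)%E).
  by rewrite -EFinD lee_fin.
rewrite leeD2r//; apply: (@le_trans _ _ (lne N%:R%:E)); last first.
  by rewrite lee_lne// in_itv/= leey andbT ?(le_trans _ Nsep)// lee_fin.
rewrite lne_EFin ?ltr0n// lee_fin.
under eq_bigr do rewrite -lnV ?posrE//.
apply: le_trans (sum_ln_le_ln_sum _ kap1 _) _.
- by move=> j; exact: fine_ge0.
- by move=> j; rewrite invr_gt0.
have kb j : kap j <= b j.
  apply: fine_measure_le => //.
    by apply: bowen_ball_measurable => //; exact: ltW.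
  move=> x /= <-; apply: (le_trans (psiP x)).
  lra.
rewrite ler_ln ?posrE ?ltr0n//; last first.
  by apply: weighted_sum_gt0 => // j; rewrite ?fine_ge0// invr_gt0.
apply: (@le_trans _ _ (\sum_(j < N) 1)); last by rewrite sumr_const card_ord.
by apply: ler_sum => j _; rewrite ler_pdivrMr// mul1r.
Qed.

End FiberBounds.

(** * Limits in the extended reals *)

Section Limits.
Context {R : realType}.
Implicit Types (u v : (\bar R)^nat).

Lemma near_right0 (Q : R -> Prop) (e1 : R) : 0 < e1 ->
  (forall e, 0 < e -> e < e1 -> Q e) -> \forall e \near (0 : R)^'+, Q e.
Proof.
move=> e10 h; near=> e; apply: h.
  by near: e; exact: nbhs_right_gt.
by near: e; exact: nbhs_right_lt.
Unshelve. all: by end_near. Qed.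

Lemma limn_einf_ge u (r : \bar R) : (\forall k \near \oo, r <= u k)%E ->
  (r <= limn_einf u)%E.
Proof.
move=> [K _ hK]; rewrite limn_einf_lim; apply: lime_ge; first exact: is_cvg_einfs.
exists K => // n /= Kn; apply: le_ereal_inf_tmp => _ [k /= nk <-].
by apply: hK => /=; exact: leq_trans nk.
Qed.

Lemma limn_esup_le u (r : \bar R) : (\forall k \near \oo, u k <= r)%E ->
  (limn_esup u <= r)%E.
Proof.
move=> [K _ hK]; rewrite limn_esup_lim; apply: lime_le; first exact: is_cvg_esups.
exists K => // n /= Kn; apply: ge_ereal_sup => _ [k /= nk <-].
by apply: hK => /=; exact: leq_trans nk.
Qed.

(** The limit of a divergent sequence is by convention the distinguished point 0
    of [\bar R]; in that case [r < 0 <= v k] for all [k]. *)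
Lemma near_ge_of_lt_limn v (r : R) : (forall k, 0 <= v k)%E -> (r%:E < limn v)%E ->
  (\forall k \near \oo, r%:E <= v k)%E.
Proof.
move=> v0 rv; have [cv|ncv] := pselect (cvgn v).
  have : nbhs (limn v) [set y | (r%:E < y)%E] by exact: open_ereal_gt'.
  by move=> /cv [K _ hK]; exists K => // k /hK /= /ltW.
move: rv; rewrite (_ : limn v = 0%E) => [rv|]; last first.
  by apply: getPN => l vl; apply: ncv; apply/cvg_ex; exists l.
by apply: nearW => k; exact: le_trans (ltW rv) (v0 k).
Qed.

Lemma limn_ge0 v : (forall k, 0 <= v k)%E -> (0 <= limn v)%E.
Proof.
move=> v0; have [cv|ncv] := pselect (cvgn v).
  by apply: lime_ge => //; exact: nearW.
rewrite (_ : limn v = 0%E)//.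
by apply: getPN => l vl; apply: ncv; apply/cvg_ex; exists l.
Qed.

Lemma lim_right0_eq (U : R -> \bar R) (h : \bar R) : (0 <= h)%E ->
    (forall delta, 0 < delta -> \forall e \near 0^'+, (U e <= h + delta%:E)%E) ->
    (forall r : R, (r%:E < h)%E -> \forall e \near 0^'+, (r%:E <= U e)%E) ->
  lim (U e @[e --> 0^'+]) = h.
Proof.
move=> h0 Uh hU; apply: cvg_lim => //.
case: h h0 Uh hU => [h| |] // h0 Uh hU; last first.
  by apply/cvgeyPge => A; apply: hU; rewrite ltry.
have bnd delta : 0 < delta ->
    \forall e \near 0^'+, ((h - delta)%:E <= U e <= (h + delta)%:E)%E.
  move=> d0; near=> e; apply/andP; split; near: e; last exact: Uh.
  by apply: hU; rewrite lte_fin ltrBlDr ltrDl.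
apply/fine_cvgP; split.
  apply: filterS (bnd 1 ltr01) => e /andP[h1 h2].
  by apply/fin_numPlt; rewrite (lt_le_trans _ h1) ?ltNyr// (le_lt_trans h2) ?ltry.
apply/cvgrPdist_le => eps eps0; apply: filterS (bnd eps eps0) => e /=.
case: (U e) => [r| |] //=; rewrite ?lee_fin => /andP[h1 h2] //.
  by rewrite ler_norml; lra.
Unshelve. all: by end_near. Qed.

End Limits.

(** * Almost everywhere statements on the product *)

Lemma ae_mono d (T : measurableType d) (R : realType)
    (mu : {measure set T -> \bar R}) (Q Q' : T -> Prop) :
    (forall x, Q x -> Q' x) ->
  {ae mu, forall x, Q x} -> {ae mu, forall x, Q' x}.
Proof.
by move=> QQ' [N [mN N0 QN]]; exists N; split=> // x nQ'; apply: QN => /QQ'.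
Qed.

Lemma ae_and d (T : measurableType d) (R : realType)
    (mu : {measure set T -> \bar R}) (Q Q' : T -> Prop) :
    {ae mu, forall x, Q x} -> {ae mu, forall x, Q' x} ->
  {ae mu, forall x, Q x /\ Q' x}.
Proof.
move=> [N [mN N0 QN]] [N' [mN' N'0 QN']].
exists (N `|` N'); split; [exact: measurableU|by rewrite measureU0|].
by move=> x /= /not_andP[nQ|nQ']; [left; exact: QN|right; exact: QN'].
Qed.

Section ProductAE.
Context {R : realType} {d1 d2 : measure_display}.
Context {T1 : measurableType d1} {T2 : measurableType d2}.
Variables (P : probability T1 R) (mu : probability T2 R).

(** By the definition of the product measure, almost every section of a null set
    is null. *)
Lemma ae_product_sections (Q : T1 * T2 -> Prop) :
  {ae (P \x mu)%E, forall z, Q z} -> {ae P, forall w, {ae mu, forall x, Q (w, x)}}.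
Proof.
move=> [N [mN N0 QN]].
have : ae_eq P setT (mu \o xsection N) (cst 0%E).
  apply/ae_eq_integral_abs => //; first exact: measurable_fun_xsection.
  rewrite -[RHS]N0 /product_measure1; apply: eq_integral => w _ /=.
  by rewrite gee0_abs.
apply: filterS => w /= /(_ I) Nw.
exists (xsection N w); split=> //; first exact: measurable_xsection.
by move=> x /= nQ; rewrite /xsection /= inE; exact: QN.
Qed.

Lemma ae_of_full_measure (A : set (T1 * T2)) :
  measurable A -> (P \x mu)%E A = 1%E -> {ae (P \x mu)%E, forall z, A z}.
Proof.
move=> mA A1; exists (~` A); split=> //; first exact: measurableC.
have PT : (P \x mu)%E setT = 1%E.
  rewrite -setXTT product_measure1E// [X in (X * _)%E]probability_setT mul1e.
  exact: probability_setT.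
have : ((P \x mu) A + (P \x mu) (~` A) = 1)%E.
  rewrite -PT -(setUv A); apply/esym/measureU => //; first exact: measurableC.
  by rewrite setICr.
rewrite A1; case: ((P \x mu)%E (~` A)) => [r| |] //.
by rewrite -EFinD => -[] /eqP; rewrite -subr_eq0 addrAC subrr add0r => /eqP ->.
Qed.

End ProductAE.

(** * Lower bound of the growth rates *)

Section EntropyRates.
Context {R : realType} {X : pointedMetricType R} {m : nat}.
Variables (f : 'I_m.+1 -> X -> X).
Variables (P : probability (Sigma m) R) (mu : probability (borel X) R).
Hypothesis Xcompact : compact [set: X].
Hypothesis fcont : forall i, continuous (f i).
Hypothesis muG : G_invariant f P mu.
Hypothesis mufull : full_support mu.

Definition moment (w : Sigma m) (k : nat) (e q : R) : \bar R :=
  (\int[mu]_x (mu (bowen_ball f w k x e) `^ (q - 1)))%E.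

Lemma partition_entropy_ge0 n (xi : 'I_n -> set (borel X)) w k :
  measurable_partition xi ->
  (0 <= partition_entropy mu (@partition_join _ _ _ f n xi w k))%E.
Proof.
move=> pxi; rewrite partition_entropyE// lee_fin sumr_ge0// => a _.
rewrite mulr_ge0 ?fine_ge0// oppr_ge0 ln_le0//.
rewrite -lee_fin fineK ?probability_le1//; first exact: partition_join_measurable.
by apply: fin_num_measure; exact: partition_join_measurable.
Qed.

Lemma moment_ge1 w k e q : 0 < e -> q <= 0 -> (1 <= moment w k e q)%E.
Proof.
move=> e0 q0.
have <- : (\int[mu]_x (cst 1 : borel X -> \bar R) x = 1)%E.
  by rewrite integral_cst// mul1e; exact: probability_setT.
apply: ge0_le_integral_nonmeas => // x.
have mB : measurable (bowen_ball f w k x e : set (borel X)).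
  by apply: bowen_ball_measurable => //; exact: ltW.
rewrite -[mu _]fineK ?fin_num_measure// poweR_EFin lee_fin.
apply: (@le_trans _ _ (1 `^ (q - 1))); first by rewrite powR1.
apply: powR_le0_antitone; first lra.
  exact: bowen_ball_gt0.
by rewrite -lee_fin fineK ?fin_num_measure// probability_le1.
Qed.

Lemma sep_card_ge1 w k e : (1 <= sep_card f w k e)%E.
Proof.
apply: ereal_sup_ubound; exists [fset point]%fset; last by rewrite cardfs1.
by move=> x y /fset1P -> /fset1P ->; rewrite eqxx.
Qed.

Lemma moment_measurable k e q :
  measurable_fun [set: Sigma m] (fun w => lne (moment w k e q)).
Proof.
apply: (finite_coordinates_measurable (k := k)) => w w' ww'.
by rewrite /moment (bowen_ball_agree f ww').
Qed.

Lemma sep_card_measurable k e :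
  measurable_fun [set: Sigma m] (fun w => lne (sep_card f w k e)).
Proof.
apply: (finite_coordinates_measurable (k := k)) => w w' ww'.
by rewrite /sep_card /separated_set (bowen_dist_agree f ww').
Qed.

(** Invariance turns the mean number of visits to [D] up to time [k] into
    [k * mu D]. *)
Lemma integral_error k (D : set (borel X)) (L1 L2 : R) :
    0 <= L1 -> 0 <= L2 -> measurable D ->
  (\int[P]_w (\sum_(i < k) (fine (mu (fiter f w i @^-1` D)) * L1 + L2))%:E =
   (k%:R * (fine (mu D) * L1 + L2))%:E)%E.
Proof.
move=> L10 L20 mD.
have mpre w i : measurable (fiter f w i @^-1` D : set (borel X)).
  by apply: continuous_measurable_preimage => //; exact: fiter_continuous.
have mmu i : measurable_fun [set: Sigma m] (fun w => mu (fiter f w i @^-1` D)).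
  apply: (finite_coordinates_measurable (k := i)) => w w' ww'.
  by rewrite (fiter_agree f ww').
have termE w i : ((fine (mu (fiter f w i @^-1` D)) * L1 + L2)%:E =
    L1%:E * mu (fiter f w i @^-1` D) + L2%:E)%E.
  by rewrite EFinD EFinM muleC fineK// fin_num_measure.
under eq_integral.
  move=> w _; rewrite -sumEFin; under eq_bigr do rewrite termE.
  over.
rewrite ge0_integral_sum//; last 2 first.
- by move=> i; apply: emeasurable_funD => //; exact: measurable_funeM.
- by move=> i w _; rewrite adde_ge0 ?mule_ge0// lee_fin.
rewrite (eq_bigr (fun=> (fine (mu D) * L1 + L2)%:E)).
  by rewrite sumEFin sumr_const card_ord mulr_natl.
move=> i _; rewrite ge0_integralD//; last 2 first.
- by move=> w _; rewrite mule_ge0// lee_fin.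
- exact: measurable_funeM.
rewrite ge0_integralZl_EFin// integral_measure_fiter_preimage//.
rewrite (_ : (\int[P]_w L2%:E = L2%:E)%E); last first.
  by rewrite integral_cst// [X in (_ * X)%E]probability_setT mule1.
by rewrite EFinD EFinM muleC fineK// fin_num_measure.
Qed.

Lemma integral_partition_entropy_le n (xi : 'I_n -> set (borel X)) (eta : R) :
    measurable_partition xi -> 0 < eta ->
  exists2 e1 : R, 0 < e1 & forall e, 0 < e -> e < e1 -> forall k,
    (\int[P]_w partition_entropy mu (@partition_join _ _ _ f n xi w k) <=
       \int[P]_w lne (sep_card f w k e) + (k%:R * eta)%:E)%E /\
    forall q, q <= 0 ->
    (\int[P]_w partition_entropy mu (@partition_join _ _ _ f n xi w k) <=
       ((1 - q)^-1)%:E * \int[P]_w lne (moment w k e q) + (k%:R * eta)%:E)%E.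
Proof.
move=> pxi eta0.
have [l lP] := partition_label pxi.
have n0 : (0 < n)%N by apply: leq_ltn_trans (ltn_ord (l point)).
have mxi i : measurable (xi i) by case: pxi.
(* The choice of a makes - ln (1 - a) = eta / 2; then D is taken so small that the
   visits to D, which cost L1 each, contribute the other half of eta. *)
pose a := 1 - expR (- (eta / 2)).
have a1 : a < 1 by rewrite /a ltrBlDr ltrDl expR_gt0.
have a0 : 0 < a by rewrite /a subr_gt0 expR_lt1 oppr_lt0 divr_gt0.
have L2E : - ln (1 - a) = eta / 2 by rewrite /a opprB addrC subrK expRK opprK.
pose L1 := ln n%:R - ln a.
have L10 : 0 <= L1.
  by rewrite subr_ge0 (le_trans (ln_le0 (ltW a1)))// ln_ge0// ler1n.
have small : 0 < eta / 2 / (L1 + 1) by rewrite !divr_gt0// ltr_wpDl.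
have [D [rho [mD muD rho0 sepD]]] := partition_separable_off_small mu mxi small.
exists (rho / 8); first by rewrite divr_gt0.
move=> e e0 er k.
have e_rho : 8 * e < rho by lra.
have a01 : 0 < a < 1 by rewrite a0.
have err_le : ((k%:R * (fine (mu D) * L1 + - ln (1 - a)))%:E <= (k%:R * eta)%:E)%E.
  rewrite lee_fin ler_wpM2l// L2E [leRHS]splitr lerD2r.
  have : fine (mu D) <= eta / 2 / (L1 + 1).
    by rewrite -lee_fin fineK ?fin_num_measure.
  move=> /(ler_wpM2r L10)/le_trans; apply.
  rewrite mulrAC ler_pdivrMr ?ltr_wpDl// ler_wpM2l ?lerDl//.
  by rewrite divr_ge0// ltW.
have L20 : 0 <= - ln (1 - a) by rewrite L2E divr_ge0// ltW.
pose err (w : Sigma m) : R :=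
  \sum_(i < k) (fine (mu (fiter f w i @^-1` D)) * L1 - ln (1 - a)).
have merr : measurable_fun [set: Sigma m] (fun w => (err w)%:E).
  apply: (finite_coordinates_measurable (k := k)) => w w' ww'.
  by congr EFin; apply: eq_bigr => i _; rewrite (fiter_agree f ww')// ltnW.
have err0 w : 0 <= err w.
  by apply: sumr_ge0 => i _; rewrite addr_ge0// mulr_ge0// fine_ge0.
have key (G : Sigma m -> \bar R) : (forall w, 0 <= G w)%E ->
    measurable_fun setT G ->
    (forall w, partition_entropy mu (@partition_join _ _ _ f n xi w k) <=
       G w + (err w)%:E)%E ->
    (\int[P]_w partition_entropy mu (@partition_join _ _ _ f n xi w k) <=
       \int[P]_w G w + (k%:R * eta)%:E)%E.
  move=> G0 mG HG; apply: (@le_trans _ _ (\int[P]_w (G w + (err w)%:E)))%E.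
    by apply: ge0_le_integral_nonmeas => // w; exact: partition_entropy_ge0.
  rewrite ge0_integralD//; last by move=> w _; rewrite lee_fin.
  by rewrite leeD2l// integral_error.
split=> [|q q0].
  apply: key => [w||w].
  - by rewrite lne_ge0 sep_card_ge1.
  - exact: sep_card_measurable.
  exact: (partition_entropy_le_sep_card fcont mufull w k pxi mD sepD a01 e0 e_rho).
have q1 : 0 <= (1 - q)^-1 by rewrite invr_ge0; lra.
rewrite -ge0_integralZl_EFin//; last 2 first.
- by move=> w _; rewrite lne_ge0 moment_ge1.
- exact: moment_measurable.
apply: key => [w||w].
- by rewrite mule_ge0 ?lee_fin// lne_ge0 moment_ge1.
- by apply: measurable_funeM; exact: moment_measurable.
exact: (partition_entropy_le_moment fcont mufull w k pxi mD sepD a01 e0 e_rho).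
Qed.

Lemma opp_correlationE e k q :
  (- ((k%:R^-1)%:E * correlation f P mu e k q) =
   (k%:R^-1)%:E * (((1 - q)^-1)%:E * \int[P]_w lne (moment w k e q)))%E.
Proof.
rewrite /correlation -/(moment _ _ _ _) -muleN -mulNe -EFinN.
by rewrite -invrN opprB.
Qed.

Lemma hmu_ge0 : (0 <= hmu f P mu)%E.
Proof.
pose xi (i : 'I_1) : set (borel X) := setT.
have pxi : measurable_partition xi.
  split; [by move=> i; exact: measurableT| |].
    by move=> i j _ _ _; rewrite !ord1.
  by apply/seteqP; split=> // x _; exists ord0.
apply: (@le_trans _ _ (hmu_part f P mu xi)); last first.
  by apply: ereal_sup_ubound; exists 1%N, xi.
apply: limn_ge0 => k; rewrite mule_ge0 ?lee_fin// integral_ge0// => w _.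
exact: partition_entropy_ge0.
Qed.

(** A real below the entropy is below the entropy of a partition by some [eta];
    after division by [k], the error of [integral_partition_entropy_le] is this
    [eta]. *)
Lemma rate_lower_bound (r : R) : (r%:E < hmu f P mu)%E ->
  exists2 e1 : R, 0 < e1 & forall e, 0 < e -> e < e1 ->
    (\forall k \near \oo,
      r%:E <= (k%:R^-1)%:E * \int[P]_w lne (sep_card f w k e))%E /\
    forall q, q <= 0 -> (\forall k \near \oo,
      r%:E <= - ((k%:R^-1)%:E * correlation f P mu e k q))%E.
Proof.
move=> /ereal_sup_gt[_ [n [xi [pxi ->]]] rxi].
have [r' rr' r'xi] : exists2 r' : R, r < r' & (r'%:E < hmu_part f P mu xi)%E.
  move: rxi; case: hmu_part => [s| |] //; rewrite ?lte_fin => rs.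
    by exists ((r + s) / 2); rewrite ?lte_fin; lra.
  by exists (r + 1); rewrite ?ltry// ltrDl.
have eta0 : 0 < r' - r by rewrite subr_gt0.
have [e1 e10 he1] := integral_partition_entropy_le pxi eta0.
exists e1 => // e e0 ee1.
have H0 k : (0 <= (k%:R^-1)%:E *
    \int[P]_w partition_entropy mu (@partition_join _ _ _ f n xi w k))%E.
  rewrite mule_ge0 ?lee_fin// integral_ge0// => w _; exact: partition_entropy_ge0.
have [K _ hK] := near_ge_of_lt_limn H0 r'xi.
have key (k : nat) (Y : \bar R) : (K <= k)%N -> (0 <= Y)%E ->
    (\int[P]_w partition_entropy mu (@partition_join _ _ _ f n xi w k) <=
     Y + (k%:R * (r' - r))%:E)%E -> (r%:E <= (k%:R^-1)%:E * Y)%E.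
  move=> Kk Y0 HY; have := hK k Kk; move=> /= /le_trans h.
  have : (r'%:E <= (k%:R^-1)%:E * (Y + (k%:R * (r' - r))%:E))%E.
    by apply: h; rewrite lee_wpmul2l// lee_fin.
  rewrite ge0_muleDr//; last by rewrite lee_fin mulr_ge0// ltW.
  rewrite -EFinM mulrA => h2.
  have : (r'%:E <= (k%:R^-1)%:E * Y + (r' - r)%:E)%E.
    apply: (le_trans h2); rewrite leeD2l// lee_fin.
    case: k {Kk HY h h2} => [|k]; first by rewrite mulr0 mul0r ltW.
    by rewrite mulVf// mul1r.
  by rewrite -leeBlDr// -EFinB opprB addrC subrK.
split=> [|q q0]; exists K => // k /= Kk.
  apply: key => //; last by have [] := he1 e e0 ee1 k.
  by apply: integral_ge0 => w _; rewrite lne_ge0 sep_card_ge1.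
rewrite opp_correlationE; apply: key => //; last first.
  by have [_] := he1 e e0 ee1 k; apply.
rewrite mule_ge0 ?lee_fin ?invr_ge0 ?subr_ge0 ?(le_trans q0)//.
by apply: integral_ge0 => w _; rewrite lne_ge0 moment_ge1.
Qed.

End EntropyRates.

(** * Upper bound of the growth rates *)

Section UpperBound.
Context {R : realType} {X : pointedMetricType R} {m : nat}.
Variables (f : 'I_m.+1 -> X -> X).
Variables (P : probability (Sigma m) R) (mu : probability (borel X) R).
Hypothesis fcont : forall i, continuous (f i).
Hypothesis mufull : full_support mu.

Lemma moment_le w k e q (c : R) : 0 < e -> q <= 0 ->
    {ae mu, forall x, expR (- c) <= fine (mu (bowen_ball f w k x e))} ->
  (lne (moment f mu w k e q) <= ((1 - q) * c)%:E)%E.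
Proof.
move=> e0 q0 hb.
have Mexp : (moment f mu w k e q <= (expR ((1 - q) * c))%:E)%E.
  apply: ge0_integral_le_cst_ae => [x|]; first exact: poweR_ge0.
  apply: ae_mono hb => x hx.
  have mB : measurable (bowen_ball f w k x e : set (borel X)).
    by apply: bowen_ball_measurable => //; exact: ltW.
  rewrite -[mu _]fineK ?fin_num_measure// poweR_EFin lee_fin.
  have := @powR_le0_antitone R (q - 1) _ _ _ (expR_gt0 _) hx.
  rewrite {2}/powR gt_eqF ?expR_gt0// expRK mulrN -mulNr opprB; apply; lra.
have M1 := moment_ge1 fcont mufull w k e0 q0.
rewrite -lne_expR lee_lne//.
- by rewrite in_itv/= leey andbT (le_trans _ M1).
- by rewrite in_itv/= leey andbT lee_fin expR_ge0.
Qed.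

(** The bound on the measure of balls holds at generic centers only, and the
    generic points are dense in the Bowen metric as balls have positive measure.
    Replacing each point of a [4 * e]-separated set by a generic one at distance
    at most [e] leaves the balls of radius [e] disjoint. *)
Lemma sep_card_le w k e (c : R) : 0 < e ->
    {ae mu, forall x, expR (- c) <= fine (mu (bowen_ball f w k x e))} ->
  (lne (sep_card f w k (4 * e)) <= c%:E)%E.
Proof.
move=> e0 [N [mN N0 hN]].
have hb x : ~ N x -> expR (- c) <= fine (mu (bowen_ball f w k x e)).
  by move=> Nx; apply: contrapT => h; apply: Nx; exact: hN.
have gen x : exists y, ~ N y /\ bowen_dist f w k x y <= e.
  apply: contrapT => h.
  pose U := [set y | forall i, (i < k)%N ->
    mdist (fiter f w i x) (fiter f w i y) < e].
  have oU : open U by exact: open_bowen_lt.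
  have : (0 < mu U)%E by apply: mufull => //; exists x => i _; rewrite mdistxx.
  rewrite ltNge => /negP; apply; rewrite -N0; apply: le_measure; rewrite ?inE//.
    exact: open_measurable_borel.
  move=> y Uy; apply: contrapT => Ny; apply: h; exists y; split=> //.
  by apply/bowen_distP => [|i ik]; [exact: ltW|exact/ltW/Uy].
have [g gP] := choice gen.
have card_le (E : {fset X}) : separated_set f w k (4 * e) E ->
    (#|` E|%:R : R) <= expR c.
  move=> sE; pose B x : set (borel X) := bowen_ball f w k (g x) e.
  have mB x : measurable (B x) by apply: bowen_ball_measurable => //; exact: ltW.
  have tB : trivIset [set` E] B.
    move=> x y /= xE yE [z [/= gxz gyz]]; apply/eqP; apply: contrapT => /negP xy.
    have := sE x y xE yE xy; rewrite ltNge => /negP; apply.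
    have [_ dx] := gP x; have [_ dy] := gP y.
    have := bowen_dist_triangle f w k x (g x) y.
    have := bowen_dist_triangle f w k (g x) z y.
    have := bowen_dist_triangle f w k z (g y) y.
    rewrite (bowen_dist_sym f w k z (g y)) (bowen_dist_sym f w k (g y) y).
    rewrite /B /bowen_ball /= in gxz gyz; lra.
  have : (mu (\big[setU/set0]_(x <- E) B x) <= 1)%E.
    by apply: probability_le1; exact: bigsetU_measurable.
  rewrite measure_fbigsetU//.
  have : ((\sum_(x <- E) expR (- c))%:E <= \sum_(x <- E) mu (B x))%E.
    rewrite -sumEFin; apply: lee_sum => x _.
    by rewrite -[leRHS]fineK ?fin_num_measure// lee_fin hb//; have [] := gP x.
  move=> /le_trans h /h; rewrite lee_fin big_const_seq count_predT iter_addr_0.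
  by rewrite -[X in X <= 1]mulr_natl expRN ler_pdivrMr ?expR_gt0// mul1r.
have : (sep_card f w k (4 * e) <= (expR c)%:E)%E.
  by apply: ge_ereal_sup => _ [E sE <-]; rewrite lee_fin card_le.
move=> hs; rewrite -lne_expR lee_lne//.
- by rewrite in_itv/= leey andbT (le_trans _ (sep_card_ge1 _ _ _ _)).
- by rewrite in_itv/= leey andbT lee_fin expR_ge0.
Qed.

Lemma le_ball_measure_of_rate w k x e (c : R) : 0 < e -> (0 < k)%N ->
    (ball_rate f mu w k x e <= c%:E)%E ->
  expR (- (k%:R * c)) <= fine (mu (bowen_ball f w k x e)).
Proof.
move=> e0 k0; have b0 := bowen_ball_gt0 fcont w k x mufull e0.
have mB : measurable (bowen_ball f w k x e : set (borel X)).
  by apply: bowen_ball_measurable => //; exact: ltW.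
rewrite /ball_rate -[mu _]fineK ?fin_num_measure// lne_EFin// -EFinM -EFinN lee_fin.
have kR : 0 < k%:R :> R by rewrite ltr0n.
rewrite -mulrN ler_pdivrMl// => h.
by rewrite -[leRHS]lnK ?posrE// ler_expR lerNl.
Qed.

Hypothesis Hunif : uniform_local_entropy f P mu.
Hypothesis Hle : {ae (P \x mu)%E, forall z : Sigma m * borel X,
       (upper_local_entropy f mu z.1 z.2 <= hmu f P mu)%E}.

(** The two almost sure hypotheses concern the product measure; they are
    combined there and then passed to the fibers. *)
Lemma ae_le_ball_measure (h delta : R) : hmu f P mu = h%:E -> 0 < delta ->
  exists2 e0 : R, 0 < e0 & forall e, 0 < e -> e < e0 ->
  exists K, forall k, (K < k)%N -> {ae P, forall w, {ae mu, forall x,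
    expR (- (k%:R * (h + delta))) <= fine (mu (bowen_ball f w k x e))}}.
Proof.
move=> hE d0; have [A [mA A1 /(_ delta d0)[e0 e00 hA]]] := Hunif.
exists e0 => // e e_gt0 ee0.
have [|K hK] := hA e; first by rewrite e_gt0 ltW.
exists K => k Kk.
apply: (ae_product_sections (P := P) (mu := mu) (Q := fun z : Sigma m * borel X =>
  expR (- (k%:R * (h + delta))) <= fine (mu (bowen_ball f z.1 k z.2 e)))).
have aeA := ae_of_full_measure mA A1.
apply: (ae_mono _ (ae_and aeA Hle)) => -[w x] /= [Awx Hwx].
apply: le_ball_measure_of_rate => //; first exact: leq_ltn_trans Kk.
apply: le_trans (hK k Kk w x Awx) _.
by rewrite EFinD leeD2r// -hE.
Qed.

Lemma rate_upper_bound (delta : R) : 0 < delta ->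
  exists2 e1 : R, 0 < e1 & forall e, 0 < e -> e < e1 ->
    (\forall k \near \oo,
      (k%:R^-1)%:E * \int[P]_w lne (sep_card f w k e) <= hmu f P mu + delta%:E)%E /\
    forall q, q <= 0 -> (\forall k \near \oo,
      - ((k%:R^-1)%:E * correlation f P mu e k q) <= hmu f P mu + delta%:E)%E.
Proof.
move=> d0; have := hmu_ge0 P mu fcont.
case hE : (hmu f P mu) => [h| |] // _; last first.
  by exists 1 => // e _ _; split=> [|q _]; apply: nearW => k; rewrite leey.
have [e0 e00 he0] := ae_le_ball_measure hE d0.
exists e0 => // e e_gt0 ee0.
have key (k : nat) (I : \bar R) : (0 < k)%N ->
    (I <= (k%:R * (h + delta))%:E)%E ->
    ((k%:R^-1)%:E * I <= h%:E + delta%:E)%E.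
  move=> k0 hI; have kR : 0 < k%:R :> R by rewrite ltr0n.
  apply: (@le_trans _ _ ((k%:R^-1)%:E * (k%:R * (h + delta))%:E)%E).
    by rewrite lee_wpmul2l// lee_fin.
  by rewrite -EFinM mulrA mulVf ?gt_eqF// mul1r EFinD.
split=> [|q q0].
  have [||K hK] := he0 (e / 4); [lra|lra|].
  exists K.+1 => // k /= Kk; apply: key; first exact: leq_ltn_trans Kk.
  apply: ge0_integral_le_cst_ae => [w|]; first by rewrite lne_ge0 sep_card_ge1.
  apply: ae_mono (hK k Kk) => w hw.
  by rewrite -[e](_ : 4 * (e / 4) = _) ?sep_card_le//; lra.
have [//|//|K hK] := he0 e.
exists K.+1 => // k /= Kk.
have q1 : 0 < 1 - q by lra.
rewrite opp_correlationE; apply: key; first exact: leq_ltn_trans Kk.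
rewrite muleC -lee_pdivlMr ?invr_gt0// invrK -EFinM mulrC.
apply: ge0_integral_le_cst_ae => [w|]; first by rewrite lne_ge0 moment_ge1.
apply: ae_mono (hK k Kk) => w hw; exact: moment_le.
Qed.

End UpperBound.

(** * The entropy identity *)

Theorem theorem1p5 (R : realType) (X : pointedMetricType R) (m : nat)
    (f : 'I_m.+1 -> X -> X) (p : 'I_m.+1 -> R)
    (P : probability (Sigma m) R) (mu : probability (borel X) R)
    (Xcompact : compact [set: X])
    (fcont : forall i, continuous (f i))
    (pP : probability_vector p)
    (PB : is_bernoulli p P)
    (muG : G_invariant f P mu)
    (mufull : full_support mu)
    (doubling : weak_entropy_doubling f P mu)
    (Hunif : uniform_local_entropy f P mu)
    (Hle : {ae (P \x mu)%E, forall z : Sigma m * borel X,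
       (upper_local_entropy f mu z.1 z.2 <= hmu f P mu)%E}) :
  (forall q : R, q <= 0 -> hcor_exists f P mu q /\ hcor f P mu q = hmu f P mu) /\
  (htop f P = hcor f P mu 0 /\ hcor f P mu 0 = hmu f P mu).
Proof.
have h0 : (0 <= hmu f P mu)%E by exact: hmu_ge0.
have upper := rate_upper_bound fcont mufull Hunif Hle.
have lower := rate_lower_bound Xcompact fcont muG mufull.
(* Eventual bounds on the rates for each small e hold for both the upper and the
   lower limit in k, and squeeze the limit in e. *)
have lim_eq (u : R -> (\bar R)^nat) :
    (forall delta, 0 < delta -> exists2 e1 : R, 0 < e1 &
       forall e, 0 < e -> e < e1 ->
         \forall k \near \oo, (u e k <= hmu f P mu + delta%:E)%E) ->
    (forall r : R, (r%:E < hmu f P mu)%E -> exists2 e1 : R, 0 < e1 &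
       forall e, 0 < e -> e < e1 -> \forall k \near \oo, (r%:E <= u e k)%E) ->
    lim (limn_esup (u e) @[e --> 0^'+]) = hmu f P mu /\
    lim (limn_einf (u e) @[e --> 0^'+]) = hmu f P mu.
  move=> uU uL; split; apply: lim_right0_eq => //.
  - move=> delta /uU[e1 e10 H1]; apply: (near_right0 e10) => e e0 /(H1 e e0).
    exact: limn_esup_le.
  - move=> r /uL[e1 e10 H1]; apply: (near_right0 e10) => e e0 /(H1 e e0) H2.
    exact: le_trans (limn_einf_ge H2) (limn_einf_sup _).
  - move=> delta /uU[e1 e10 H1]; apply: (near_right0 e10) => e e0 /(H1 e e0) H2.
    exact: le_trans (limn_einf_sup _) (limn_esup_le H2).
  - move=> r /uL[e1 e10 H1]; apply: (near_right0 e10) => e e0 /(H1 e e0).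
    exact: limn_einf_ge.
have hcorE q : q <= 0 ->
    hcor_upper f P mu q = hmu f P mu /\ hcor_lower f P mu q = hmu f P mu.
  move=> q0; apply: lim_eq.
    move=> delta /upper[e1 e10 H1]; exists e1 => // e e0 ee1.
    by have [_] := H1 e e0 ee1; apply.
  move=> r /lower[e1 e10 H1]; exists e1 => // e e0 ee1.
  by have [_] := H1 e e0 ee1; apply.
have [cor0 _] := hcorE 0 (lexx 0).
split=> [q q0|].
  by have [Eu El] := hcorE q q0; rewrite /hcor_exists /hcor Eu El.
split=> //; rewrite /hcor cor0.
apply: (lim_eq _ _ _).2.
  move=> delta /upper[e1 e10 H1]; exists e1 => // e e0 ee1.
  by have [] := H1 e e0 ee1.
move=> r /lower[e1 e10 H1]; exists e1 => // e e0 ee1.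
by have [] := H1 e e0 ee1.
Qed.
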